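(* There is a convex Lipschitz function $\gamma_0:[1,2]\to\mathbb R$ whose graph $\Gamma_0$ satisfies \[ T(\Gamma_0)=1, \] but such that for every nondegenerate interval $I\subset[1,2]$, if \[ \sigma_I=\mathcal H^1|_{\{(x,\gamma_0(x)):x\in I\}}, \] then $\sigma_I$ is not a Rajchman measure. More precisely, there is a unit vector $\omega_I\in\mathbb R^2$ such that \[ \widehat{\sigma_I}(R\omega_I)\not\longrightarrow0\qquad\text{as }R\to\infty . \]
   Context: For a compact curve $\Gamma\subset\mathbb R^2$, \[ T(\Gamma)=\inf\{t:\ \dim_{\mathrm H}(E)>t\Longrightarrow|E+\Gamma|>0\ \text{ for every compact }E\subset\mathbb R^2\}, \] where $E+\Gamma=\{x+y:x\in E,\ y\in\Gamma\}$, $|\cdot|$ is planar Lebesgue measure, and $\dim_{\mathrm H}$ is Hausdorff dimension. $\mathcal H^1|_B$ is one-dimensional Hausdorff measure restricted to $B$. For a finite Borel measure $\nu$ on $\mathbb R^2$, $\widehat\nu(\xi)=\int e^{-2\pi i x\cdot\xi}\,d\nu(x)$; $\nu$ is a Rajchman measure if $\widehat\nu(\xi)\to0$ as $|\xi|\to\infty$. Nondegenerate interval means interval of positive length. *)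

(* Defs.v *)
From HB Require Import structures.
From mathcomp Require Import all_boot all_order all_algebra.
From mathcomp Require Import complex.
From mathcomp Require Import all_classical all_reals all_analysis.
From mathcomp Require Import measurable_realfun.

Set Implicit Arguments.
Unset Strict Implicit.
Unset Printing Implicit Defensive.

Import Order.TTheory GRing.Theory Num.Theory numFieldNormedType.Exports.

Local Open Scope classical_set_scope.
Local Open Scope ring_scope.
Local Open Scope ereal_scope.

Section hausdorff_def.
Context {R : realType}.
Implicit Types (A B : set (R * R)) (x y : R * R) (s delta : R).

(* The canonical norm of [R * R] is the sup norm, hence the explicit
   Euclidean norm. *)
Definition enorm x : R := Num.sqrt (x.1 ^+ 2 + x.2 ^+ 2)%R.

Definition dotp x y : R := (x.1 * y.1 + x.2 * y.2)%R.

Definition ediam A : \bar R :=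
  ereal_sup [set (enorm (p.1 - p.2)%R)%:E | p in A `*` A].

(* diam(A)^s, with the convention that the empty set contributes 0 (also for
   s = 0, so that H^0 is the counting measure). *)
Definition hausdorff_gauge s A : \bar R :=
  if A == set0 then 0 else ediam A `^ s.

Definition hausdorff_cover delta A : set ((set (R * R))^nat) :=
  [set F | A `<=` \bigcup_k F k /\ forall k, ediam (F k) <= delta%:E].

Definition hausdorff_delta s delta A : \bar R :=
  ereal_inf [set \sum_(k <oo) hausdorff_gauge s (F k)
            | F in hausdorff_cover delta A].

Definition hausdorff s A : \bar R :=
  ereal_sup [set hausdorff_delta s delta A | delta in [set d : R | (0 < d)%R]].

Definition dimH A : \bar R :=
  ereal_inf [set s%:E | s in [set s : R | (0 <= s)%R /\ hausdorff s A = 0]].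

(* H^s restricted to an arbitrary set [B]; it is shown below to be a measure on
   the Borel sets (Caratheodory's criterion, applied to the half-planes
   that generate the Borel sigma-algebra of [R * R]). *)
Definition hausdorff_restr s B A : \bar R := hausdorff s (A `&` B).

End hausdorff_def.

Section hausdorff_outer_measure.
Context {R : realType}.
Implicit Types (A B P Q : set (R * R)) (s delta : R).

Lemma hausdorff_gauge_ge0 s A : 0 <= hausdorff_gauge s A.
Proof. by rewrite /hausdorff_gauge; case: ifP => // _; exact: poweR_ge0. Qed.

Lemma hausdorff_gauge0 s : hausdorff_gauge s (@set0 (R * R)) = 0.
Proof. by rewrite /hausdorff_gauge eqxx. Qed.

Lemma ediam0 : ediam (@set0 (R * R)) = -oo.
Proof. by rewrite /ediam set0X image_set0 ereal_sup0. Qed.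

Lemma hausdorff_delta_ge0 s delta A : 0 <= hausdorff_delta s delta A.
Proof.
apply: le_ereal_inf_tmp => _ [F _ <-].
by apply: nneseries_ge0 => k _ _; exact: hausdorff_gauge_ge0.
Qed.

Lemma hausdorff_delta_le s delta A B : A `<=` B ->
  hausdorff_delta s delta A <= hausdorff_delta s delta B.
Proof.
move=> AB; apply: ereal_inf_le_tmp => _ [F [BF Fd] <-].
by exists F => //; split => //; exact: subset_trans BF.
Qed.

Lemma hausdorff_delta_decr s d1 d2 A : (d1 <= d2)%R ->
  hausdorff_delta s d2 A <= hausdorff_delta s d1 A.
Proof.
move=> d12; apply: ereal_inf_le_tmp => _ [F [AF Fd] <-].
by exists F => //; split => // k; rewrite (le_trans (Fd k))// lee_fin.
Qed.

Lemma hausdorff_delta0 s delta : hausdorff_delta s delta set0 = 0.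
Proof.
apply/eqP; rewrite eq_le hausdorff_delta_ge0 andbT.
apply: ereal_inf_lbound; exists (fun=> set0).
  by split => // k; rewrite ediam0 leNye.
by rewrite eseries0 // => k _ _; exact: hausdorff_gauge0.
Qed.

Lemma hausdorff_delta_sigma_subadditive s delta :
  sigma_subadditive (hausdorff_delta s delta).
Proof.
move=> A; have [[i ioo]|] :=
    pselect (exists i, hausdorff_delta s delta (A i) = +oo).
  rewrite (eseries_pinfty _ _ ioo) ?leey// => n _.
  by rewrite -ltNye (lt_le_trans _ (hausdorff_delta_ge0 _ _ _)).
rewrite -forallNE => Aoo.
suff add2e (e : {posnum R}) : hausdorff_delta s delta (\bigcup_n A n) <=
    \sum_(i <oo) hausdorff_delta s delta (A i) + e%:num%:E.
  by apply/lee_addgt0Pr => _/posnumP[].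
rewrite (le_trans _ (epsilon_trick _ _ _))//; last first.
  by move=> n; exact: hausdorff_delta_ge0.
pose P n (B : (set (R * R))^nat) := hausdorff_cover delta (A n) B /\
  \sum_(k <oo) hausdorff_gauge s (B k) <=
  hausdorff_delta s delta (A n) + (e%:num / (2 ^ n.+1)%:R)%:E.
have [G PG] : {G : ((set (R * R))^nat)^nat & forall n, P n (G n)}.
  apply: (@choice _ _ P) => n; rewrite /P /hausdorff_delta.
  set S := (X in ereal_inf X).
  have Sfin : ereal_inf S \is a fin_num.
    rewrite ge0_fin_numE; last exact: (hausdorff_delta_ge0 s delta (A n)).
    by rewrite ltey; apply/eqP; exact: Aoo.
  have en1 : (0 < e%:num / (2 ^ n.+1)%:R)%R by rewrite divr_gt0// ltr0n expn_gt0.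
  have [x [B cB <-] xS] := lb_ereal_inf_adherent en1 Sfin.
  by exists B; split => //; exact/ltW.
have G_ge0 x : 0 <= (hausdorff_gauge s \o uncurry G) x.
  exact: hausdorff_gauge_ge0.
apply: (@le_trans _ _ (\esum_(i in setT) (hausdorff_gauge s \o uncurry G) i)).
  apply: ereal_inf_lbound => /=.
  have /card_esym/ppcard_eqP[f] := card_nat2.
  exists (uncurry G \o f).
    split => [|i]; last first.
      by rewrite /uncurry/=; case: (f i) => a b; exact: (PG a).1.2.
    apply: (@subset_trans _ (\bigcup_n \bigcup_k G n k)) => [t [i _]|].
      by move=> /((PG i).1.1) -[j _ ?]; exists i => //; exists j.
    move=> t [i _ [j _ Bijt]]; exists (f^-1%FUN (i, j)) => //=.
    by rewrite invK ?inE.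
  rewrite -(esum_pred_image (hausdorff_gauge s \o uncurry G) _ xpredT)
    ?[fun=> _]set_true//.
  by rewrite image_eq.
rewrite (_ : esum _ _ =
    \sum_(i <oo) \sum_(j <oo) hausdorff_gauge s (G i j)); last first.
  pose J : nat -> set (nat * nat) := fun i => [set (i, j) | j in setT].
  rewrite (_ : setT = \bigcup_k J k); last first.
    by rewrite predeqE => -[a b]; split => // _; exists a => //; exists b.
  rewrite esum_bigcupT /=; last 2 first.
    - apply/trivIsetP => i j _ _ ij.
      rewrite predeqE => -[n m] /=; split => //= -[] [_] _ [<-{n} _].
      by move=> [m' _] [] /esym/eqP; rewrite (negbTE ij).
    - by move=> /= [n m]; exact: G_ge0 (n, m).
  rewrite -(image_id [set: nat]) -fun_true esum_pred_image//; last first.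
    by move=> n _; apply: esum_ge0 => x _; exact: G_ge0 x.
  apply: eq_eseriesr => /= j _.
  rewrite -(esum_pred_image (hausdorff_gauge s \o uncurry G) (pair j) predT)//=;
    last by move=> ? ? _ _; exact: (@can_inj _ _ _ snd).
    by congr esum; rewrite predeqE => -[a b]; split; move=> [i _ <-]; exists i.
  by move=> n _; exact: (G_ge0 (j, n)).
apply: lee_nneseries => n _; last exact: (PG n).2.
by move=> _; apply: nneseries_ge0 => m *; exact: (G_ge0 (n, m)).
Qed.

Lemma hausdorff_delta_le_hausdorff s delta A : (0 < delta)%R ->
  hausdorff_delta s delta A <= hausdorff s A.
Proof. by move=> d0; apply: ereal_sup_ubound; exists delta. Qed.

Lemma hausdorff_ge0 s A : 0 <= hausdorff s A.
Proof.
exact: le_trans (hausdorff_delta_ge0 s 1 A) (hausdorff_delta_le_hausdorff _ _ _).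
Qed.

Lemma hausdorff_le s A B : A `<=` B -> hausdorff s A <= hausdorff s B.
Proof.
move=> AB; apply: ge_ereal_sup => _ [d d0 <-].
apply: le_trans (hausdorff_delta_le s d AB) _.
exact: hausdorff_delta_le_hausdorff.
Qed.

Lemma hausdorff0 s : hausdorff s set0 = 0.
Proof.
apply/eqP; rewrite eq_le hausdorff_ge0 andbT.
by apply: ge_ereal_sup => _ [d _ <-]; rewrite hausdorff_delta0.
Qed.

Lemma hausdorff_sigma_subadditive s : sigma_subadditive (@hausdorff R s).
Proof.
move=> F; apply: ge_ereal_sup => _ [d d0 <-].
apply: le_trans (hausdorff_delta_sigma_subadditive s d F) _.
apply: lee_nneseries => k _; last exact: hausdorff_delta_le_hausdorff.
by move=> _; exact: hausdorff_delta_ge0.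
Qed.

HB.instance Definition _ s := isOuterMeasure.Build R (R * R)%type
  (@hausdorff R s) (hausdorff0 s) (hausdorff_ge0 s) (@hausdorff_le s)
  (@hausdorff_sigma_subadditive s).

Lemma hausdorff_restr0 s B : hausdorff_restr s B set0 = 0.
Proof. by rewrite /hausdorff_restr set0I hausdorff0. Qed.

Lemma hausdorff_restr_ge0 s B A : 0 <= hausdorff_restr s B A.
Proof. exact: hausdorff_ge0. Qed.

Lemma hausdorff_restr_le s B :
  {homo (hausdorff_restr s B) : X Y / X `<=` Y >-> X <= Y}.
Proof. by move=> X Y XY; apply: hausdorff_le; exact: setSI. Qed.

Lemma hausdorff_restr_sigma_subadditive s B :
  sigma_subadditive (hausdorff_restr s B).
Proof.
move=> F; rewrite /hausdorff_restr setI_bigcupl.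
exact: hausdorff_sigma_subadditive.
Qed.

HB.instance Definition _ s B := isOuterMeasure.Build R (R * R)%type
  (hausdorff_restr s B) (hausdorff_restr0 s B) (hausdorff_restr_ge0 s B)
  (@hausdorff_restr_le s B) (@hausdorff_restr_sigma_subadditive s B).

Lemma le_enorm (x : R * R) : (`|x.1| <= enorm x)%R /\ (`|x.2| <= enorm x)%R.
Proof.
by split; rewrite /enorm -sqrtr_sqr ler_wsqrtr// ?lerDl ?lerDr sqr_ge0.
Qed.

Definition separated_by (g : R * R -> R) P Q := exists2 e : R, (0 < e)%R &
  forall p q, P p -> Q q -> (g p + e <= g q)%R.

Lemma hausdorff_separated s (g : R * R -> R) P Q :
  (forall x y, `|g x - g y| <= enorm (x - y))%R ->
  separated_by g P Q ->
  hausdorff s P + hausdorff s Q <= hausdorff s (P `|` Q).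
Proof.
move=> glip [e e0 PQ].
have step d : (0 < d)%R -> (d < e)%R ->
    hausdorff_delta s d P + hausdorff_delta s d Q <= hausdorff s (P `|` Q).
  move=> d0 de; apply: le_trans (hausdorff_delta_le_hausdorff s _ d0).
  apply: le_ereal_inf_tmp => _ [F [cF dF] <-].
  pose G (C : set (R * R)) k := if F k `&` C == set0 then set0 else F k.
  have Gcov (C : set (R * R)) : C `<=` P `|` Q ->
      hausdorff_cover d C (G C).
    move=> CPQ; split => [x Cx|k].
      have [k _ Fkx] := cF _ (CPQ _ Cx); exists k => //; rewrite /G.
      by case: eqP => // /seteqP[/(_ x)]; case.
    by rewrite /G; case: ifP => // _; rewrite ediam0 leNye.
  apply: (@le_trans _ _ (\sum_(k <oo) hausdorff_gauge s (G P k) +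
                         \sum_(k <oo) hausdorff_gauge s (G Q k))).
    apply: leeD; apply: ereal_inf_lbound.
    - by exists (G P) => //; apply: Gcov; exact: subsetUl.
    - by exists (G Q) => //; apply: Gcov; exact: subsetUr.
  rewrite -nneseriesD; [|by move=> k _ _; exact: hausdorff_gauge_ge0..].
  apply: lee_nneseries => k _.
    by move=> _; apply: adde_ge0; exact: hausdorff_gauge_ge0.
  rewrite /G; case: ifPn => [_|/set0P[p [Fp Pp]]].
    rewrite hausdorff_gauge0 add0e; case: ifP => // _.
    by rewrite hausdorff_gauge0 hausdorff_gauge_ge0.
  case: ifPn => [_|/set0P[q [Fq Qq]]]; first by rewrite hausdorff_gauge0 adde0.
  exfalso; have : (enorm (q - p)%R)%:E <= d%:E.
    by apply: le_trans (dF k); apply: ereal_sup_ubound; exists (q, p).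
  rewrite lee_fin leNgt => /negP; apply; apply: lt_le_trans de _.
  apply: le_trans (glip q p); apply: le_trans (ler_norm _).
  by rewrite lerBrDl; exact: PQ.
have [->|PQoo] := eqVneq (hausdorff s (P `|` Q)) +oo; first exact: leey.
have PQfin : hausdorff s (P `|` Q) \is a fin_num.
  by rewrite ge0_fin_numE ?hausdorff_ge0// ltey.
have subfin C : C `<=` P `|` Q -> hausdorff s C \is a fin_num.
  move=> CPQ; rewrite ge0_fin_numE ?hausdorff_ge0//.
  by apply: le_lt_trans (hausdorff_le s CPQ) _; rewrite ltey.
have Pfin := subfin P (@subsetUl _ P Q).
have Qfin := subfin Q (@subsetUr _ P Q).
have dfin d C : (0 < d)%R -> hausdorff s C \is a fin_num ->
    hausdorff_delta s d C \is a fin_num.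
  move=> d0; rewrite !ge0_fin_numE ?hausdorff_ge0 ?hausdorff_delta_ge0//.
  exact: le_lt_trans (hausdorff_delta_le_hausdorff s C d0).
rewrite -leeBrDr//; apply: ge_ereal_sup => _ [d1 /= d10 <-].
rewrite leeBrDr// addeC -leeBrDr ?dfin//; apply: ge_ereal_sup => _ [d2 /= d20 <-].
rewrite leeBrDr ?dfin// addeC.
pose d := Num.min (e / 2)%R (Num.min d1 d2).
have d0 : (0 < d)%R by rewrite !lt_min d10 d20 divr_gt0.
have de : (d < e)%R by rewrite !gt_min; apply/orP; left; rewrite gtr_pMr ?invf_lt1 ?ltr1n.
apply: le_trans (step d d0 de).
by apply: leeD; apply: hausdorff_delta_decr; rewrite !ge_min lexx ?orbT.
Qed.

Lemma hausdorff_caratheodory s (g : R * R -> R) c :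
  (forall x y, `|g x - g y| <= enorm (x - y))%R -> forall W,
  hausdorff s (W `&` [set x | (c < g x)%R]) +
  hausdorff s (W `&` ~` [set x | (c < g x)%R]) <= hausdorff s W.
Proof.
move=> glip W; set A := [set x | (c < g x)%R].
have [->|Woo] := eqVneq (hausdorff s W) +oo; first exact: leey.
have Wfin : hausdorff s W \is a fin_num.
  by rewrite ge0_fin_numE ?hausdorff_ge0// ltey.
pose t (n : nat) : R := (n.+1%:R^-1)%R.
have tlt m n : (m < n)%N -> (t n < t m)%R.
  by move=> mn; rewrite /t ltf_pV2 ?posrE ?ltr0n// ltr_nat ltnS.
have tle m n : (m <= n)%N -> (t n <= t m)%R.
  by move=> mn; rewrite /t lef_pV2 ?posrE ?ltr0n// ler_nat ltnS.
have t0 n : (0 < t n)%R by rewrite /t invr_gt0 ltr0n.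
pose U n := W `&` [set x | (c + t n <= g x)%R].
pose D n := W `&` [set x | (c + t n.+2 <= g x)%R /\ (g x < c + t n.+1)%R].
have UW n : U n `<=` W by exact: subIsetl.
have half i n : \sum_(j < n) hausdorff s (D (j.*2 + i)%N) <=
    hausdorff s (U (n.*2 + i)%N).
  elim: n => [|n IH]; first by rewrite big_ord0 hausdorff_ge0.
  rewrite big_ord_recr/= addeC; apply: le_trans (leeD2l _ IH) _.
  apply: le_trans (hausdorff_separated s glip _) _.
    exists (t (n.*2 + i) - t (n.*2 + i).+1)%R; first by rewrite subr_gt0 tlt.
    move=> p q [_ [_ pt]] [_ qt]; apply: le_trans qt.
    by rewrite addrCA [leRHS]addrC lerD2l lerBlDr ltW.
  apply: hausdorff_le => x [[Wx [xt _]]|[Wx xt]]; split => //=.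
  by apply: le_trans xt; rewrite lerD2l tle// leq_add2r leq_double leqnSn.
have Doo : \sum_(k <oo) hausdorff s (D k) < +oo.
  apply: (@le_lt_trans _ _ (hausdorff s W + hausdorff s W)); last first.
    by rewrite lte_add_pinfty// -ge0_fin_numE// hausdorff_ge0.
  apply: lime_le.
    by apply: is_cvg_nneseries => *; exact: hausdorff_ge0.
  apply: nearW => n.
  have le2 : (n <= n.*2)%N by rewrite -addnn leq_addr.
  apply: (@le_trans _ _ (\sum_(0 <= k < n.*2) hausdorff s (D k))).
    by apply: lee_sum_nneg_natr => // k _ _; exact: hausdorff_ge0.
  have -> : \sum_(0 <= k < n.*2) hausdorff s (D k) =
      \sum_(j < n) hausdorff s (D (j.*2 + 0)%N) +
      \sum_(j < n) hausdorff s (D (j.*2 + 1)%N).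
    rewrite -big_split/= big_mkord {le2}; elim: n => [|n IH].
      by rewrite !big_ord0.
    by rewrite doubleS !big_ord_recr/= IH addn0 addn1 addeA.
  by apply: leeD; apply: le_trans (half _ _) _; exact: hausdorff_le.
have key n : hausdorff s (W `&` A) + hausdorff s (W `&` ~` A) <=
    hausdorff s W + \sum_(n <= k <oo) hausdorff s (D k).
  have cov : W `&` A `<=` U n.+1 `|` \bigcup_(k in ~` `I_n) D k.
    move=> x [Wx Ax]; have [xt|xt] := leP (c + t n.+1)%R (g x); first by left.
    right; have ex : exists m, (c + t m <= g x)%R.
      have gc0 : (0 < g x - c)%R by rewrite subr_gt0.
      exists (Num.truncn (g x - c)^-1)%R.
      rewrite -lerBrDl /t -[leRHS]invrK lef_pV2 ?posrE ?ltr0n ?invr_gt0//.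
      by rewrite ltW// truncnS_gt// invr_ge0 ltW.
    case: (ex_minnP ex) => m xm mmin.
    have nm : (n.+1 < m)%N.
      rewrite ltnNge; apply/negP => mn; move: xt; rewrite ltNge => /negP; apply.
      by apply: le_trans xm; rewrite lerD2l tle.
    case: m nm xm mmin => [|[|k]]// nk xm mmin; exists k => /=.
      by apply/negP; rewrite -leqNgt -ltnS -ltnS.
    split => //; split => //=; rewrite ltNge; apply/negP => /mmin.
    by rewrite ltnn.
  apply: (@le_trans _ _ (hausdorff s (U n.+1) + hausdorff s (W `&` ~` A) +
                         \sum_(n <= k <oo) hausdorff s (D k))).
    rewrite addeAC; apply: leeD => //; apply: le_trans (hausdorff_le s cov) _.
    apply: le_trans (outer_measureU2 (@hausdorff R s) _ _) _; apply: leeD => //.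
    exact: (outer_measure_sigma_subadditive_tail (@hausdorff R s)).
  apply: leeD => //; rewrite addeC.
  apply: le_trans (hausdorff_separated s glip _) _.
    exists (t n.+1) => // p q [_ pA] [_ qU]; apply: le_trans qU.
    by rewrite lerD2r leNgt; exact/negP.
  by apply: hausdorff_le => x [[]|[]].
have cvgD : (hausdorff s W + \sum_(n <= k <oo) hausdorff s (D k))
    @[n --> \oo] --> hausdorff s W + 0.
  apply: cvgeD => //; first by rewrite fin_num_adde_defr.
  - exact: cvg_cst.
  - by apply: nneseries_tail_cvg => // k _; exact: hausdorff_ge0.
rewrite -[leRHS]adde0 -(cvg_lim _ cvgD)//; apply: lime_ge.
  by apply/cvg_ex; exists (hausdorff s W + 0).
by apply: nearW => n; exact: key.
Qed.

Lemma sigma_algebra_caratheodory (T : Type)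
  (mu : {outer_measure set T -> \bar R}) : sigma_algebra setT mu.-caratheodory.
Proof.
split.
- exact: caratheodory_measurable_set0.
- by move=> A; rewrite setTD; exact: caratheodory_measurable_setC.
- exact: caratheodory_measurable_bigcup.
Qed.

Lemma hausdorff_restr_caratheodory s B A : measurable A ->
  (hausdorff_restr s B).-caratheodory A.
Proof.
have [M0 MC MU] := sigma_algebra_caratheodory (hausdorff_restr s B).
have coord (g : R * R -> R) :
    (forall x y, `|g x - g y| <= enorm (x - y))%R -> forall Y, measurable Y ->
    (hausdorff_restr s B).-caratheodory (g @^-1` Y).
  move=> glip Y mY.
  have GY : (@RGenOInfty.G R).-sigma.-measurable Y.
    by rewrite -RGenOInfty.measurableE.
  suff sub : <<s @RGenOInfty.G R >> `<=`
      [set Z | (hausdorff_restr s B).-caratheodory (g @^-1` Z)] by exact: sub.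
  apply: smallest_sub.
    split.
    - by rewrite /= preimage_set0.
    - by move=> Z MZ; rewrite /= setTD preimage_setC -setTD; exact: MC.
    - by move=> F MF; rewrite /= preimage_bigcup; exact: MU.
  move=> _ [c ->] /=; rewrite set_itvoy.
  apply: le_caratheodory_measurable => X.
  have := hausdorff_caratheodory s c glip (X `&` B).
  by rewrite !(setIAC X B).
apply: smallest_sub => // _ [[Y mY <-]|[Y mY <-]]; rewrite setTI.
- by apply: coord => // x y; exact: (le_enorm (x - y)%R).1.
- by apply: coord => // x y; exact: (le_enorm (x - y)%R).2.
Qed.

Lemma hausdorff_restr_semi_sigma_additive s B :
  semi_sigma_additive (hausdorff_restr s B : set (R * R) -> \bar R).
Proof.
move=> F mF tF mUF.
by apply: (@caratheodory_measure_sigma_additive R _ (hausdorff_restr s B)) => //;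
  [move=> i|]; exact: hausdorff_restr_caratheodory.
Qed.

HB.instance Definition _ s B := isMeasure.Build _ (R * R)%type R
  (hausdorff_restr s B) (hausdorff_restr0 s B) (hausdorff_restr_ge0 s B)
  (@hausdorff_restr_semi_sigma_additive s B).

End hausdorff_outer_measure.

Local Close Scope ereal_scope.

Section sum_threshold.
Context {R : realType}.

Definition minkowski_sum (E G : set (R * R)) : set (R * R) :=
  [set x + y | x in E & y in G].

Definition lebesgue2 : set (R * R) -> \bar R :=
  (@lebesgue_measure R \x @lebesgue_measure R)%E.

(* T(G); the infimum is taken in the extended reals. *)
Definition sum_threshold (G : set (R * R)) : \bar R :=
  ereal_inf [set t%:E | t in [set t : R |
    forall E : set (R * R), compact E ->
      (t%:E < dimH E)%E -> (0 < lebesgue2 (minkowski_sum E G))%E]].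

Definition graph_on (f : R -> R) (I : set R) : set (R * R) :=
  [set (x, f x) | x in I].

End sum_threshold.

Section fourier.
Context {R : realType}.
Local Open Scope complex_scope.
Implicit Type nu : {measure set (R * R) -> \bar R}.

(* The integral of exp(-2 i pi x.xi), split into real and imaginary parts. *)
Definition fourier nu (xi : R * R) : R[i] :=
  (\int[nu]_x cos (- (2 * pi * dotp x xi))) +i*
  (\int[nu]_x sin (- (2 * pi * dotp x xi))).

Definition at_infinity : set_system (R * R) :=
  filter_from [set: R] (fun M => [set xi | M < enorm xi]).

(* Meant for finite measures; on infinite ones the integrals defining
   [fourier] need not converge. *)
Definition rajchman nu : Prop :=
  fourier nu xi @[xi --> at_infinity] --> (0 : R[i] : numFieldType).

End fourier.

(* Main.v *)
Require Import Defs.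
From HB Require Import structures.
From mathcomp Require Import all_boot all_order all_algebra.
From mathcomp Require Import complex.
From mathcomp Require Import all_classical all_reals all_analysis.
From mathcomp Require Import measurable_realfun ring lra.

(** Choose a compact K in [1, 2] of positive length that contains no rational
    number, and let gamma0 be the supremum of the tangents, at the abscissas k
    in K, of the parabola y = x^2 / 2.  As a supremum of affine functions with
    slopes in [1, 2] it is convex and Lipschitz.  Two features of this function
    pull in opposite directions.

    On K it coincides with x^2 / 2, so its graph contains the part of a
    parabola that lies over K, a set of positive length.  This forces
    T(Gamma_0) <= 1 (lebesgue2_minkowski_sum_gt0): if the set E has dimension
    more than 1, some s > 1 has H^s(E) > 0.  At scale d = 2^-n, a finite form of
    Frostman's lemma (discrete_frostman) gives points p_i of E and weights w_i
    whose total is bounded below independently of n, such that the ball of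
    radius 2^-k around each p_i has weight at most 2^-(ks), for k0 <= k <= n.
    Let A_i be the points within vertical distance d of the part of the parabola
    over K, translated by p_i.  Two translates of a parabola meet
    transversally, with slopes that differ by the horizontal displacement, so
    A_i and A_j overlap in area at most a constant times d^2 / |p_i - p_j|
    (parabola_piece_overlap).  With W the total weight, the Frostman condition
    with s > 1 bounds the sum of w_i w_j |A_i & A_j| by a constant times
    d^2 W (W + 1), while the sum of w_i |A_i| is a constant times d W; by the
    Cauchy-Schwarz inequality (second_moment_le) the union of the A_i has area
    at least a constant times W / (W + 1), hence bounded below.
    This union lies within a bounded multiple of d of the compact set
    E + Gamma_0, and d tends to 0.

    The bound T(Gamma_0) >= 1 holds for every continuous function on [1, 2]:
    if C is a null compact set of reals, each vertical section of
    ({0} x C) + Gamma_0 is a translate of C, so that the sum is null; and C may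
    be a symmetric Cantor set of dimension as close to 1 as desired
    (exists_null_compact_dimH_gt).

    Off K the function is locally affine apart from isolated kinks: around a
    rational q, the point k of K nearest to q remains the nearest one all the
    way from q to k, so the supremum is given there by the tangent at k
    (tangent_envelope_flat).  Every nondegenerate interval I thus contains a
    segment over which the graph is a line segment.  Projected on the normal
    direction w of that segment, the measure sigma_I has an atom.  A finite
    measure with an atom has a Fourier transform that does not tend to 0, by the
    positivity of the Fejer kernel (atom_cos_integral_not_small). *)

Import Order.TTheory GRing.Theory Num.Theory numFieldNormedType.Exports.

Local Open Scope classical_set_scope.
Local Open Scope ring_scope.

(** * Second moments of weighted families of sets *)

Lemma integral_indic_sum d (T : measurableType d) (R : realType)
    (mu : {measure set T -> \bar R}) (I : finType) (c : I -> R) (B : I -> set T) :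
  (forall i, 0 <= c i) -> (forall i, measurable (B i)) ->
  (\int[mu]_x (\sum_i c i * \1_(B i) x)%:E = \sum_i (c i)%:E * mu (B i))%E.
Proof.
move=> c0 mB; under eq_integral do rewrite -sumEFin.
rewrite ge0_integral_sum//.
- apply: eq_bigr => i _; under eq_integral do rewrite EFinM.
  rewrite ge0_integralZl_EFin ?integral_indic ?setIT//.
  exact/measurable_EFinP/measurable_indic.
- move=> i; exact/measurable_EFinP/measurable_funM.
- by move=> i x _; rewrite lee_fin mulr_ge0.
Qed.

(** Cauchy-Schwarz in polarised form: integrate the pointwise inequality
    2 t f <= f^2 + t^2 on S, where f is the weighted sum of the indicators of
    the A i.  Leaving t free avoids divisions of extended reals. *)
Lemma second_moment_le d (T : measurableType d) (R : realType)
    (mu : {measure set T -> \bar R}) (I : finType) (w : I -> R)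
    (A : I -> set T) (S : set T) (t : R) :
  (forall i, 0 <= w i) -> (forall i, measurable (A i)) -> measurable S ->
  (forall i, A i `<=` S) -> 0 <= t ->
  (\sum_i (2 * t * w i)%:E * mu (A i) <=
   \sum_i \sum_j (w i * w j)%:E * mu (A i `&` A j) + (t ^+ 2)%:E * mu S)%E.
Proof.
move=> w0 mA mS AS t0.
have mI (J : finType) (c : J -> R) (B : J -> set T) :
    (forall j, measurable (B j)) ->
    measurable_fun setT (fun x => (\sum_j c j * \1_(B j) x)%:E).
  move=> mB; apply/measurable_EFinP/measurable_sum => j.
  exact: measurable_funM.
rewrite -integral_indic_sum//; last by move=> i; rewrite !mulr_ge0.
pose c' (p : I * I) := w p.1 * w p.2; pose A' (p : I * I) := A p.1 `&` A p.2.
have mA' p : measurable (A' p) by exact: measurableI.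
have c0' p : 0 <= c' p by exact: mulr_ge0.
rewrite pair_big/= -(@integral_indic_sum _ _ _ mu _ c' A')//.
have -> : mu S = (\int[mu]_x (\1_S x)%:E)%E by rewrite integral_indic// setIT.
have mS1 : measurable_fun setT (fun x => (\1_S x : R)%:E).
  by apply/measurable_EFinP; exact: measurable_indic.
rewrite -ge0_integralZl_EFin//; last by rewrite sqr_ge0.
rewrite -ge0_integralD//; last 4 first.
- by move=> x _; rewrite lee_fin sumr_ge0// => p _; rewrite mulr_ge0.
- exact: mI.
- by move=> x _; rewrite -EFinM lee_fin mulr_ge0// sqr_ge0.
- by apply: measurable_funeM.
apply: ge0_le_integral => //.
- by move=> x _; rewrite lee_fin sumr_ge0// => i _; rewrite !mulr_ge0.
- exact: mI.
- by apply: emeasurable_funD; [exact: mI|exact: measurable_funeM].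
move=> x _; rewrite -EFinM -EFinD lee_fin.
pose f := \sum_i w i * \1_(A i) x.
have -> : \sum_p c' p * \1_(A' p) x = f ^+ 2.
  rewrite expr2 mulr_suml; under [RHS]eq_bigr do rewrite mulr_sumr.
  rewrite pair_big/=; apply: eq_bigr => p _.
  by rewrite /c' /A' indicI/= mulrACA.
have -> : \sum_i 2 * t * w i * \1_(A i) x = 2 * t * f.
  by rewrite mulr_sumr; apply: eq_bigr => i _; rewrite mulrA.
have [Sx|Sx] := pselect (S x).
  by rewrite indicE mem_set// mulr1; have := sqr_ge0 (f - t); nra.
suff -> : f = 0 by rewrite mulr0 expr0n/= add0r mulr_ge0// sqr_ge0.
rewrite /f big1// => i _; rewrite indicE memNset ?mulr0//.
by move/AS.
Qed.

(** * Planar Lebesgue measure and compact sets *)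

(** Translation invariance, by uniqueness of the measure that extends length. *)
Lemma lebesgue_measure_translate (R : realType) (c : R) (A : set R) :
  measurable A -> lebesgue_measure [set x | A (x - c)] = lebesgue_measure A.
Proof.
move=> mA; pose f x : measurableTypeR R := (x : measurableTypeR R) - c.
have mf : measurable_fun setT f by exact: measurable_funB.
pose f' := mfun_Sub (mem_set mf).
apply/esym/(lebesgue_measure_unique (mu := pushforward lebesgue_measure f')) => //.
move=> _ [[a b] _ <-]; transitivity (lebesgue_measure `]a + c, b + c]%classic).
  by rewrite !lebesgue_measure_itv/= !lte_fin ltrD2r -!EFinB opprD addrACA subrr
    addr0.
by congr (lebesgue_measure _); apply/seteqP; split => x /=;
  rewrite /f !in_itv/= ltrBrDr lerBlDr.
Qed.

Lemma compact_net (R : realType) (E : set (R * R)) (e : R) : compact E -> 0 < e ->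
  exists s : seq (R * R), (forall x, x \in s -> E x) /\
    (forall x, E x -> exists2 y, y \in s & `|y - x| < e).
Proof.
(* Compactness by open covers is stated for pointed spaces. *)
pose T : ptopologicalType :=
  HB.pack_for ptopologicalType (R * R)%type (isPointed.Build _ (0 : R * R)).
move=> + e0; rewrite (@compact_cover T) => cE.
have [x _||D DE cD] := cE _ E (fun x => ball x e).
- exact: ball_open.
- by move=> x Ex; exists x => //; exact: ballxx.
exists (finmap.enum_fset D); split=> [x /DE|x /cD[y /= yD]]; first by rewrite inE.
by rewrite -ball_normE => xy; exists y.
Qed.

Lemma measurable_ball2 (R : realType) (x : R * R) (e : R) :
  measurable (ball x e : set (R * R)).
Proof.
have -> : ball x e = ball x.1 e `*` ball x.2 e by [].
by apply: measurableX; exact: measurable_ball.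
Qed.

(** The measurable subsets of the plane are those of the product structure, so
    that compact sets have to be produced from rectangles: a compact set is the
    intersection over n of finite unions of balls of radius 1 / (n + 1), which
    are squares. *)
Lemma compact_measurable2 (R : realType) (E : set (R * R)) :
  compact E -> measurable E.
Proof.
move=> cE.
have h (n : nat) : exists s : seq (R * R), (forall x, x \in s -> E x) /\
    (forall x, E x -> exists2 y, y \in s & `|y - x| < n.+1%:R^-1).
  by apply: compact_net => //; rewrite invr_gt0.
have [s sE] := choice h.
rewrite (_ : E = \bigcap_n \big[setU/set0]_(y <- s n) ball y n.+1%:R^-1).
  apply: bigcapT_measurable => n.
  by elim: (s n) => [|y l IH]; rewrite ?big_nil// big_cons; apply: measurableU => //;
    exact: measurable_ball2.
apply/seteqP; split=> [x Ex n _|x Ex].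
  have [y ys xy] := (sE n).2 _ Ex.
  by rewrite -bigcup_seq; exists y => //; rewrite -ball_normE.
have clE : closed E by apply: compact_closed => //; exact: norm_hausdorff.
apply: clE => U /nbhs_ballP[e /= e0 eU].
have [n ne] : exists n, n.+1%:R^-1 < e.
  exists (Num.truncn e^-1); rewrite invf_plt ?posrE// truncnS_gt//.
have := Ex n Logic.I; rewrite -bigcup_seq => -[y /= ys yx].
exists y; split; first exact: (sE n).1.
by apply: eU; apply: (le_ball (ltW ne)); exact: ball_sym.
Qed.

(** Planar Lebesgue measure is built on two copies of the line whose
    sigma-algebra is generated by half-open intervals; the next lemmas view it
    as a measure for the canonical measurable structure of the plane. *)
Lemma lebesgue2_set0 (R : realType) : lebesgue2 (set0 : set (R * R)) = 0%E.
Proof. exact: (measure0 (@lebesgue_measure R \x @lebesgue_measure R)%E). Qed.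

Lemma lebesgue2_ge0 (R : realType) (A : set (R * R)) : (0 <= lebesgue2 A)%E.
Proof. exact: (measure_ge0 (@lebesgue_measure R \x @lebesgue_measure R)%E). Qed.

Lemma lebesgue2_semi_sigma_additive (R : realType) :
  semi_sigma_additive (lebesgue2 : set (R * R) -> \bar R).
Proof.
exact: (measure_semi_sigma_additive
  (s := (@lebesgue_measure R \x @lebesgue_measure R)%E)).
Qed.

HB.instance Definition _ (R : realType) := isMeasure.Build _ (R * R)%type R
  (@lebesgue2 R) (lebesgue2_set0 R) (@lebesgue2_ge0 R) (@lebesgue2_semi_sigma_additive R).

Lemma lebesgue_measure_segment (R : realType) (c d : R) : 0 <= d ->
  lebesgue_measure [set t : R | `|t - c| <= d] = (2 * d)%:E.
Proof.
move=> d0; rewrite [X in lebesgue_measure X](_ : _ = `[c - d, c + d]%classic).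
  rewrite lebesgue_measure_itv/= lte_fin; case: ltP => h.
    by rewrite -EFinB; congr EFin; ring.
  by congr EFin; lra.
by apply/seteqP; split => t /=; rewrite in_itv/= ler_distl.
Qed.

Lemma lebesgue2_slab_le (R : realType) (A : set (R * R)) (a b d : R) (c : R -> R) :
  measurable A -> a <= b -> 0 <= d ->
  (forall y, A y -> a <= y.1 <= b /\ `|y.2 - c y.1| <= d) ->
  (lebesgue2 A <= (2 * d * (b - a))%:E)%E.
Proof.
move=> mA ab d0 Ac; rewrite /lebesgue2 /product_measure1.
have -> : ((2 * d * (b - a))%:E = \int[lebesgue_measure]_x
    ((2 * d)%:E * (\1_(`[a, b]%classic : set R) x)%:E))%E.
  rewrite ge0_integralZl_EFin//; last by rewrite mulr_ge0.
    rewrite integral_indic// setIT EFinM; congr (_ * _)%E.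
    rewrite -[RHS]/(lebesgue_measure `[a, b]%classic) lebesgue_measure_itv/= lte_fin.
    by case: ltP => // ba; rewrite (_ : a = b) ?subrr//; apply: le_anti; rewrite ab.
  exact/measurable_EFinP/measurable_indic.
apply: ge0_le_integral => //.
- exact: measurable_fun_xsection.
- apply: measurable_funeM; exact/measurable_EFinP/measurable_indic.
move=> x _ /=; rewrite indicE.
have [xab|xab] := pselect (a <= x <= b).
  rewrite mem_set/= ?in_itv// mule1 -(lebesgue_measure_segment _ (c x))//.
  apply: le_measure; rewrite ?inE; first exact: measurable_xsection.
    rewrite [X in measurable X](_ : _ = `[c x - d, c x + d]%classic)//.
    by apply/seteqP; split => t /=; rewrite in_itv/= ler_distl.
  by move=> t /xsectionP /Ac[].
rewrite (_ : xsection _ _ = set0) ?measure0 ?mule_ge0// ?lee_fin ?mulr_ge0//.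
by rewrite -subset0 => t /xsectionP /Ac[].
Qed.

Lemma exists_expr_le (R : realType) (x e : R) : 0 <= x < 1 -> 0 < e ->
  exists n, x ^+ n <= e.
Proof.
move=> /andP[x0 x1] e0; have : `|x| < 1 by rewrite ger0_norm.
move=> /cvg_expr/cvgr0Pnorm_le/(_ e e0)[N _ /(_ N (leqnn N)) h].
by exists N; rewrite (le_trans (ler_norm _)).
Qed.

Lemma exists_half_expr_le (R : realType) (e : R) : 0 < e ->
  exists k, 2^-1 ^+ k <= e.
Proof. by apply: exists_expr_le; rewrite invr_ge0 ler0n invf_lt1 ?ltr1n. Qed.

Lemma compact_minkowski_sum (R : realType) (E G : set (R * R)) :
  compact E -> compact G -> compact (minkowski_sum E G).
Proof.
move=> cE cG.
have -> : minkowski_sum E G = (fun p : (R * R) * (R * R) => p.1 + p.2) @` (E `*` G).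
  apply/seteqP; split=> [_ [x Ex [y Gy <-]]|_ [[x y] [/= Ex Gy] <-]].
    by exists (x, y).
  by exists x => //; exists y.
apply: continuous_compact; last exact: compact_setX.
apply: continuous_subspaceT => p; exact: add_continuous.
Qed.

Lemma compact_lebesgue2_lty (R : realType) (E : set (R * R)) :
  compact E -> (lebesgue2 E < +oo)%E.
Proof.
move=> cE; have [M0 [_ EM0]] := compact_bounded cE.
pose M := `|M0| + 1; have M_ge0 : 0 <= M by rewrite addr_ge0.
have EM y : E y -> `|y| <= M.
  by apply: EM0; rewrite /M (le_lt_trans (ler_norm _))// ltrDl.
apply: (@le_lt_trans _ _ (2 * M * (M - - M))%:E); last exact: ltry.
apply: (@lebesgue2_slab_le _ _ _ _ _ (fun=> 0)) => //.
- exact: compact_measurable2.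
- by rewrite ge0_cp.
- by move=> y /EM; rewrite prod_normE ge_max subr0 -ler_norml => /andP[].
Qed.

Lemma bigcap_thickening (R : realType) (C : set (R * R)) : compact C ->
  \bigcap_n minkowski_sum C
    (`[- 2^-1 ^+ n, 2^-1 ^+ n]%classic `*` `[- 2^-1 ^+ n, 2^-1 ^+ n]%classic) = C.
Proof.
move=> cC; apply/seteqP; split=> [y Cy|y Cy n _]; last first.
  exists y => //; exists 0; rewrite ?addr0//.
  by split; rewrite /= in_itv/= oppr_le0 exprn_ge0.
have : closed C by apply: compact_closed => //; exact: norm_hausdorff.
apply=> U /nbhs_ballP[e /= e0 eU].
have [k ke] := @exists_half_expr_le R (e / 2) (divr_gt0 e0 (ltr0n _ 2)).
have [c Cc [z [/= z1 z2] cz]] := Cy k Logic.I.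
exists c; split=> //; apply: eU; rewrite -ball_normE /= -cz addrAC subrr add0r.
rewrite prod_normE gt_max !ltr_norml; move: z1 z2; rewrite !in_itv/=; lra.
Qed.

(** * Overlaps of thickened parabola pieces *)

(** The points at vertical distance at most d from the part of the parabola
    y = x^2 / 2 that lies over K, translated by p. *)
Definition parabola_piece {R : realType} (K : set R) (d : R) (p : R * R) :
    set (R * R) :=
  [set y | K (y.1 - p.1) /\ `|y.2 - (p.2 + (y.1 - p.1) ^+ 2 / 2)| <= d].

Lemma measurable_parabola_piece (R : realType) (K : set R) (d : R) p :
  measurable K -> measurable (parabola_piece K d p).
Proof.
move=> mK; apply: measurableI.
  have mf : measurable_fun setT (fun y : R * R => y.1 - p.1).
    by apply: measurable_funB => //; exact: measurable_fst.
  by rewrite -[X in measurable X]setTI; exact: mf.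
have m1 : measurable_fun setT (fun y : R * R => y.1 - p.1).
  by apply: measurable_funB => //; exact: measurable_fst.
have mf : measurable_fun setT (fun y : R * R =>
    `|y.2 - (p.2 + (y.1 - p.1) ^+ 2 / 2)| <= d).
  apply: measurable_fun_ler => //; apply: measurableT_comp => //.
  apply: measurable_funB; first exact: measurable_snd.
  apply: measurable_funD => //; apply: measurable_funM => //.
  exact: measurable_funX.
have := mf measurableT [set true] Logic.I.
by rewrite setTI; congr (measurable _); apply/seteqP; split => y.
Qed.

(** All vertical sections over the translate of K are segments of length 2 d. *)
Lemma lebesgue2_parabola_piece (R : realType) (K : set R) (d : R) p :
  measurable K -> 0 <= d ->
  lebesgue2 (parabola_piece K d p) = ((2 * d)%:E * lebesgue_measure K)%E.
Proof.
move=> mK d0; rewrite /lebesgue2 /product_measure1.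
have mKp : measurable [set x | K (x - p.1)].
  have mf : measurable_fun setT (fun y : R => y - p.1) by exact: measurable_funB.
  by rewrite -[X in measurable X]setTI; exact: mf.
rewrite -(lebesgue_measure_translate _ p.1 _ mK).
transitivity (\int[lebesgue_measure]_x
    ((2 * d)%:E * (\1_[set x | K (x - p.1)] x)%:E))%E; last first.
  rewrite ge0_integralZl_EFin//; first by rewrite integral_indic ?setIT.
    exact/measurable_EFinP/measurable_indic.
  by rewrite mulr_ge0.
apply: eq_integral => x _ /=; rewrite indicE.
have [Kx|Kx] := pselect (K (x - p.1)).
  rewrite mem_set// mule1 -(lebesgue_measure_segment _ (p.2 + (x - p.1) ^+ 2 / 2))//.
  congr lebesgue_measure; apply/seteqP; split => t /=.
    by move/xsectionP => [].
  by move=> tc; apply/xsectionP.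
rewrite memNset// mule0.
rewrite (_ : xsection _ _ = set0) ?measure0//.
by rewrite -subset0 => t /xsectionP[].
Qed.

(** Over the abscissa y1, both pieces are within d of their parabolas, whose
    heights differ by |h (y1 - m) - v| with h and v the horizontal and vertical
    displacements and m a constant.  If h is comparable with |p - q| this
    confines y1 to an interval of length of order d / |p - q|; if v dominates,
    the pieces meet only when |p - q| is of order d.  The constant 16 covers
    both cases. *)
Lemma parabola_piece_overlap (R : realType) (K : set R) (d : R) (p q : R * R) :
  measurable K -> K `<=` `[1, 2]%classic -> 0 < d ->
  exists x : R, [/\ 0 <= x, x <= 1, x * `|p - q| <= 16 * d &
    (lebesgue2 (parabola_piece K d p `&` parabola_piece K d q) <=
     (2 * d * x)%:E)%E].
Proof.
move=> mK K12 d0; set A := _ `&` _.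
have mA : measurable A by apply: measurableI; exact: measurable_parabola_piece.
have K1 y : K y -> 1 <= y <= 2 by move=> /K12; rewrite /= in_itv.
have /orP D_hv : (`|p - q| == `|p.1 - q.1|) || (`|p - q| == `|p.2 - q.2|).
  by rewrite prod_normE/= /Num.max; case: ifP => _; rewrite eqxx ?orbT.
have hD : `|p.1 - q.1| <= `|p - q| by rewrite prod_normE/= le_max lexx.
have close y : A y -> `|(p.1 - q.1) * (y.1 - (p.1 + q.1) / 2) - (p.2 - q.2)| <= 2 * d.
  move=> [[_ yp] [_ yq]].
  have := ler_distD (y.2) (p.2 + (y.1 - p.1) ^+ 2 / 2) (q.2 + (y.1 - q.1) ^+ 2 / 2).
  rewrite (distrC _ y.2) => /le_trans/(_ (lerD yp yq)) h.
  rewrite -normrN; apply: (@le_trans _ _ (d + d)); last by lra.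
  by apply: le_trans h; rewrite le_eqVlt; apply/orP; left; apply/eqP; congr `|_|; field.
(* For a displacement of order d, the length of [1, 2] is a sufficient bound. *)
have [Dd|dD] := leP `|p - q| (16 * d).
  exists 1; rewrite mul1r; split => //.
  rewrite [X in (X)%:E](_ : _ = 2 * d * (p.1 + 2 - (p.1 + 1))); last by ring.
  apply: (@lebesgue2_slab_le _ _ _ _ _ (fun x => p.2 + (x - p.1) ^+ 2 / 2)) => //.
  - by lra.
  - exact: ltW.
  - by move=> y [[/K1 yp ?] _]; split=> //; lra.
(* The horizontal displacement is comparable with the distance: transversality
   confines the abscissas of A to an interval centred at c. *)
have [Dh|hD4] := leP `|p - q| (4 * `|p.1 - q.1|).
  have h0 : 0 < `|p.1 - q.1| by lra.
  have hn0 : p.1 - q.1 != 0 by rewrite -normr_gt0.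
  set h := p.1 - q.1 in close Dh h0 hn0 hD D_hv *.
  exists (4 * d / `|h|); split.
  - by rewrite divr_ge0// mulr_ge0// ltW.
  - by rewrite ler_pdivrMr//; lra.
  - by rewrite mulrAC ler_pdivrMr//; nra.
  pose c := (p.1 + q.1) / 2 + (p.2 - q.2) / h.
  rewrite [X in (X)%:E](_ : _ = 2 * d * (c + 2 * d / `|h| - (c - 2 * d / `|h|))); last first.
    by field; rewrite gt_eqF.
  apply: (@lebesgue2_slab_le _ _ _ _ _ (fun x => p.2 + (x - p.1) ^+ 2 / 2)) => //.
  - have : 0 < 2 * d / `|h| by rewrite divr_gt0 ?mulr_gt0.
    by lra.
  - exact: ltW.
  - move=> y Ay; split; last by case: Ay => -[].
    rewrite -ler_distl ler_pdivlMr// -normrM.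
    by have := close _ Ay; congr (`|_| <= _); rewrite /c; field.
(* The vertical displacement exceeds what the difference of slopes can make up
   for, and the pieces are disjoint. *)
exists 0; rewrite mulr0 mul0r; split => //; first by rewrite mulr_ge0// ltW.
suff -> : A = set0 by rewrite measure0.
rewrite -subset0 => y Ay; have := close _ Ay.
case: D_hv => /eqP D_hv; first by move: hD4; rewrite D_hv; lra.
move: Ay => [[/K1 yp _] [/K1 yq _]].
have m2 : `|y.1 - (p.1 + q.1) / 2| <= 2 by rewrite ler_norml; lra.
set h := p.1 - q.1 in hD4 hD *; set v := p.2 - q.2 in D_hv *.
set m := y.1 - _ in m2 *.
have := lerB_dist v (h * m); rewrite distrC normrM.
have := ler_pM (normr_ge0 h) (normr_ge0 m) (lexx _) m2.
by rewrite -D_hv; lra.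
Qed.

(** * A finite form of Frostman's lemma *)

(** The greedy proof of the max-flow min-cut inequality behind Frostman's
    lemma: treat the points one after the other, and give each the largest
    weight that respects all the capacities, which saturates some constraint
    through that point.  A constraint, once saturated, remains so. *)
Lemma saturated_weights (R : realFieldType) (I J : finType) (B : J -> {set I})
    (c : J -> R) :
  (forall j, 0 <= c j) -> (forall i, exists j, i \in B j) ->
  exists w : I -> R, [/\ forall i, 0 <= w i,
    forall j, \sum_(i in B j) w i <= c j &
    forall i, exists2 j, i \in B j & \sum_(k in B j) w k = c j].
Proof.
move=> c0 covB.
suff [w [w0 wc wt]] : exists w : I -> R, [/\ forall i, 0 <= w i,
    forall j, \sum_(i in B j) w i <= c j &
    forall i, i \in enum I -> exists2 j, i \in B j & \sum_(k in B j) w k = c j].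
  by exists w; split=> // i; apply: wt; rewrite mem_enum.
elim: (enum I) => [|i s [w [w0 wc wt]]].
  by exists (fun=> 0); split=> // j; rewrite big1.
have [j0 ij0] := covB i.
pose slack j := c j - \sum_(k in B j) w k.
(* m is a tightest constraint through i. *)
have [m im mmin] : exists2 m, i \in B m & forall j, i \in B j -> slack m <= slack j.
  by case: (@arg_minP _ _ _ j0 (fun j => i \in B j) slack ij0) => m im mmin; exists m.
have t0 : 0 <= slack m by rewrite subr_ge0.
pose w' k := w k + (k == i)%:R * slack m.
have sw' j : \sum_(k in B j) w' k = \sum_(k in B j) w k + (i \in B j)%:R * slack m.
  rewrite big_split/=; congr (_ + _); rewrite -mulr_suml; congr (_ * _).
  have [iB|iB] := boolP (i \in B j).
    by rewrite (bigD1 i)//= eqxx big1 ?addr0// => k /andP[_ /negPf->].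
  by rewrite big1// => k kB; case: eqP => // ki; move: iB; rewrite -ki kB.
exists w'; split=> [k|j|k].
- by rewrite addr_ge0// mulr_ge0.
- rewrite sw'; have [iB|_] := boolP (i \in B j); last by rewrite mul0r addr0.
  by rewrite mul1r -lerBrDl; exact: mmin.
rewrite inE => /predU1P[->|/wt[j kj wj]].
  by exists m => //; rewrite sw' im mul1r addrC subrK.
exists j => //; rewrite sw'; have [iB|_] := boolP (i \in B j); last by rewrite mul0r addr0.
have := mmin _ iB; rewrite {2}/slack wj subrr => t1.
by rewrite (_ : slack m = 0) ?mulr0 ?addr0//; apply: le_anti; rewrite t0 t1.
Qed.

(** Vitali's selection for finite families, stated without a metric: ranks
    stand for radii, a smaller rank for a larger radius. *)
Lemma finite_vitali (T : eqType) (meet : rel T) (rank : T -> nat) (s : seq T) :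
  reflexive meet ->
  exists D : seq T, [/\ {subset D <= s}, pairwise (fun x y => ~~ meet x y) D &
    forall x, x \in s -> exists2 y, y \in D & meet y x && (rank y <= rank x)%N].
Proof.
move=> rm; pose LE x y := (rank x <= rank y)%N.
have LEt : transitive LE by move=> y x z; exact: leq_trans.
suff H n : forall s, (size s <= n)%N -> sorted LE s ->
    exists D : seq T, [/\ {subset D <= s}, pairwise (fun x y => ~~ meet x y) D &
    forall x, x \in s -> exists2 y, y \in D & meet y x && (rank y <= rank x)%N].
  have LEtot : total LE by move=> x y; exact: leq_total.
  have [D [Ds pD cD]] := H _ _ (leqnn _) (sort_sorted LEtot s).
  exists D; split=> // x; first by move=> /Ds; rewrite mem_sort.
  by rewrite -(mem_sort LE) => /cD.
elim: n => [|n IH] [|x {}s]//=; do ?by exists [::].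
rewrite ltnS => sn xs.
have [||D [Ds pD cD]] := IH [seq y <- s | ~~ meet x y].
- by rewrite size_filter (leq_trans (count_size _ _)).
- exact: (sorted_filter LEt) (path_sorted xs).
exists (x :: D); split.
- move=> y; rewrite !inE => /predU1P[->|/Ds]; first by rewrite eqxx.
  by rewrite mem_filter => /andP[_ ->]; rewrite orbT.
- rewrite /= pD andbT; apply/allP => y /Ds.
  by rewrite mem_filter => /andP[].
move=> y; rewrite inE => /predU1P[->|ys].
  by exists x; rewrite ?mem_head// rm leqnn.
have [xy|xy] := boolP (meet x y).
  exists x; rewrite ?mem_head// xy/=.
  by have /allP := order_path_min LEt xs; exact.
have [|z zD zy] := cD y; first by rewrite mem_filter xy.
by exists z => //; rewrite inE zD orbT.
Qed.

(** Finite covers are admissible: complete them by empty sets, whose gauge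
    vanishes. *)
Lemma hausdorff_delta_finite_cover (R : realType) (s delta : R) (A : set (R * R))
    (D : seq (set (R * R))) :
  (forall x, A x -> exists2 X, X \in D & X x) ->
  (forall X, X \in D -> (ediam X <= delta%:E)%E) ->
  (hausdorff_delta s delta A <= \sum_(X <- D) hausdorff_gauge s X)%E.
Proof.
move=> AD dD; pose F k := nth set0 D k.
apply: (@le_trans _ _ (\sum_(k <oo) hausdorff_gauge s (F k))%E).
  apply: ereal_inf_lbound; exists F => //; split=> [x /AD[X XD Xx]|k].
    by exists (seq.index X D) => //; rewrite /F nth_index.
  have [kD|kD] := ltnP k (size D); first by apply: dD; exact: mem_nth.
  by rewrite /F nth_default// ediam0 leNye.
rewrite (nneseries_split 0 (size D))//; last by move=> k _; exact: hausdorff_gauge_ge0.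
rewrite add0n [X in (_ + X)%E]eseries0 ?adde0; last first.
  by move=> k kD _; rewrite /F nth_default ?hausdorff_gauge0.
by rewrite (big_nth set0).
Qed.

Lemma enorm_le_norm (R : realType) (x : R * R) : enorm x <= 2 * `|x|.
Proof.
have [h1 h2] : `|x.1| <= `|x| /\ `|x.2| <= `|x|.
  by rewrite prod_normE; split; rewrite le_max lexx ?orbT.
have n0 : 0 <= 2 * `|x| by rewrite mulr_ge0.
rewrite -[leRHS](ger0_norm n0) -sqrtr_sqr ler_wsqrtr//.
rewrite -(real_normK (num_real x.1)) -(real_normK (num_real x.2)).
by have := normr_ge0 x.1; have := normr_ge0 x.2; nra.
Qed.

Lemma ediam_le (R : realType) (A : set (R * R)) (r : R) :
  (forall x y, A x -> A y -> `|x - y| <= r) -> (ediam A <= (2 * r)%:E)%E.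
Proof.
move=> Ar; apply: ge_ereal_sup => _ [[x y] /= [Ax Ay] <-].
rewrite lee_fin (le_trans (enorm_le_norm _ _))// ler_pM2l//; exact: Ar.
Qed.

Lemma hausdorff_gauge_le (R : realType) (s r : R) (A : set (R * R)) :
  0 <= s -> 0 <= r -> (ediam A <= r%:E)%E -> (hausdorff_gauge s A <= (r `^ s)%:E)%E.
Proof.
move=> s0 r0 Ar; rewrite /hausdorff_gauge; case: eqP => [_|/eqP/set0P[x Ax]].
  by rewrite lee_fin powR_ge0.
have A0 : (0 <= ediam A)%E.
  apply: ereal_sup_ubound; exists (x, x) => //=.
  by rewrite subrr /enorm/= expr0n/= addr0 sqrtr0.
by rewrite -poweR_EFin; apply: gt0_ler_poweR; rewrite ?in_itv/= ?lee_fin ?r0 ?leey ?A0.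
Qed.

Lemma sum_disjoint_le (R : realFieldType) (I : finType) (T : eqType) (B : T -> {set I})
    (w : I -> R) (D : seq T) :
  (forall i, 0 <= w i) -> pairwise (fun x y => ~~ [exists i, (i \in B x) && (i \in B y)]) D ->
  \sum_(d <- D) \sum_(i in B d) w i <= \sum_i w i.
Proof.
move=> w0 pD.
apply: (@le_trans _ _ (\sum_(i | has (fun d => i \in B d) D) w i)); last first.
  by rewrite [leRHS](bigID (fun i => has (fun d => i \in B d) D))/= lerDl sumr_ge0.
elim: D pD => [|d D IH]/=; first by rewrite big_nil sumr_ge0.
move=> /andP[/allP dD /IH{}IH]; rewrite big_cons.
rewrite [leRHS](bigID (fun i => i \in B d))/=; apply: lerD.
  rewrite le_eqVlt; apply/orP; left; apply/eqP; apply: eq_bigl => i.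
  by case: (i \in B d); rewrite ?andbF.
apply: le_trans IH _.
rewrite le_eqVlt; apply/orP; left; apply/eqP; apply: eq_bigl => i.
have [id|id] := boolP (i \in B d); rewrite ?andbT// andbF.
by apply/negbTE/hasPn => e /dD /existsPn/(_ i); rewrite id.
Qed.

Lemma powR_exprn (R : realType) (x s : R) (n : nat) : 0 <= x ->
  (x ^+ n) `^ s = (x `^ s) ^+ n.
Proof.
move=> x0; elim: n => [|n IH]; first by rewrite !expr0 powR1.
by rewrite !exprS powRM ?exprn_ge0// IH.
Qed.

(** From the centre x1 of a selected ball to a point x5 close to the net: x2 is
    a point common to the selected ball and to the saturated ball of centre x3,
    and x4 is the point of the net that this ball covers. *)
Lemma norm_chain (R : realFieldType) (V : normedZmodType R) (x1 x2 x3 x4 x5 : V)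
    (r : R) :
  `|x1 - x2| <= r -> `|x3 - x2| <= r -> `|x3 - x4| <= r -> `|x4 - x5| <= r ->
  `|x1 - x5| <= 4 * r.
Proof.
rewrite (distrC x3 x2) => h12 h23 h34 h45.
have := ler_distD x2 x1 x5; have := ler_distD x3 x2 x5; have := ler_distD x4 x3 x5.
by lra.
Qed.

(** The weights come from saturated_weights, with the balls of radius 2^-k
    around the points of a 2^-n net of E as constraints and 2^-(ks) as
    capacities.  The saturated balls cover the net; by finite_vitali, a family
    of saturated balls of which no two share a point of the net covers E after
    a dilation by the factor 4.  The sum of their capacities is then at most
    the total weight, and up to the factor 16^s it bounds the Hausdorff content
    of E. *)
Lemma discrete_frostman (R : realType) (E : set (R * R)) (s : R) (k0 n : nat) :
  compact E -> 0 <= s -> (k0 <= n)%N ->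
  exists N (p : 'I_N -> R * R) (w : 'I_N -> R),
    [/\ forall i, E (p i), forall i, 0 <= w i,
      forall i k, (k0 <= k <= n)%N ->
        \sum_(j | `|p i - p j| <= 2^-1 ^+ k) w j <= (2^-1 `^ s) ^+ k &
      (hausdorff_delta s (16 * 2^-1 ^+ k0) E <= (16 `^ s * \sum_i w i)%:E)%E].
Proof.
move=> cE s0 kn; have h0 k : 0 < 2^-1 ^+ k :> R by rewrite exprn_gt0.
have [net [netE netc]] := compact_net _ _ _ cE (h0 n).
pose p (i : 'I_(size net)) := nth 0 net i.
have Ep i : E (p i) by apply: netE; exact: mem_nth.
pose J := ('I_(size net) * 'I_(n - k0).+1)%type.
pose lev (j : J) := (k0 + j.2)%N.
pose B (j : J) := finset (fun i => `|p j.1 - p i| <= 2^-1 ^+ lev j).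
pose c (j : J) : R := (2^-1 `^ s) ^+ lev j.
have BE (i : 'I_(size net)) (j : J) : (i \in B j) = (`|p j.1 - p i| <= 2^-1 ^+ lev j).
  by rewrite inE.
have Bself (i : 'I_(size net)) a : i \in B (i, a) by rewrite BE/= subrr normr0 ltW.
have [||w [w0 wc wt]] := @saturated_weights R _ _ B c.
- by move=> j; rewrite exprn_ge0// powR_ge0.
- by move=> i; exists (i, ord0).
exists (size net), p, w; split=> //.
  move=> i k /andP[k0k kn'].
  have kk : (k - k0 < (n - k0).+1)%N by rewrite ltnS leq_sub2r.
  have := wc (i, Ordinal kk); rewrite /c /lev/= subnKC//.
  by under eq_bigl do rewrite BE /lev/= subnKC//.
pose sat (j : J) := \sum_(k in B j) w k == c j.
pose meet (x y : J) := [exists i, (i \in B x) && (i \in B y)].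
have rm : reflexive meet by move=> [i a]; apply/existsP; exists i; rewrite Bself.
have [D [Ds pD cD]] := finite_vitali _ meet lev [seq j <- enum {: J} | sat j] rm.
have Dsat j : j \in D -> \sum_(k in B j) w k = c j.
  by move=> /Ds; rewrite mem_filter => /andP[/eqP].
pose F (j : J) := [set y : R * R | `|p j.1 - y| <= 4 * 2^-1 ^+ lev j].
have dF j : (ediam (F j) <= (16 * 2^-1 ^+ lev j)%:E)%E.
  rewrite (_ : 16 * _ = 2 * (8 * 2^-1 ^+ lev j)); last by ring.
  apply: ediam_le => x y Fx Fy; apply: le_trans (ler_distD (p j.1) _ _) _.
  by move: Fx Fy; rewrite /F/= (distrC _ x); lra.
have lev_le (a b : nat) : (a <= b)%N -> 2^-1 ^+ b <= 2^-1 ^+ a :> R.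
  by move=> ab; apply: ler_wiXn2l => //; rewrite invf_le1 ?ler1n.
apply: le_trans (hausdorff_delta_finite_cover _ _ _ _ [seq F j | j <- D] _ _) _.
- move=> x /netc[y /(nthP 0)[i ilt <-]] yx.
  have [j iB wj] := wt (Ordinal ilt).
  have [|d dD /andP[/existsP[k /andP[kd kj]] ldj]] := cD j.
    by rewrite mem_filter /sat wj eqxx mem_enum.
  exists (F d); first exact: map_f.
  rewrite /F/=; move: iB kd kj; rewrite !BE => iB kd kj.
  have ld := lev_le _ _ ldj.
  have nd : 2^-1 ^+ n <= 2^-1 ^+ lev d :> R.
    by apply: lev_le; rewrite -[leqRHS](subnKC kn) leq_add2l -ltnS ltn_ord.
  apply: (@norm_chain _ _ _ (p k) (p j.1) (p (Ordinal ilt))) => //.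
  - exact: le_trans ld.
  - exact: le_trans ld.
  - exact: le_trans (ltW yx) nd.
- move=> X /mapP[j _ ->]; apply: le_trans (dF j) _.
  by rewrite lee_fin ler_pM2l// lev_le// leq_addr.
rewrite big_map; apply: (@le_trans _ _ (\sum_(j <- D) (16 `^ s * c j)%:E)%E).
  apply: lee_sum => j _; apply: le_trans (hausdorff_gauge_le _ _ _ _ s0 _ (dF j)) _.
    by rewrite mulr_ge0// ltW.
  rewrite lee_fin powRM ?exprn_ge0//.
  by rewrite powR_exprn// invr_ge0.
rewrite sumEFin lee_fin -mulr_sumr ler_pM2l ?powR_gt0//.
rewrite (eq_big_seq (fun j => \sum_(k in B j) w k)); first exact: sum_disjoint_le.
by move=> j /Dsat.
Qed.

(** * Sums of a set of dimension greater than one with a parabola piece *)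

(** A dyadic majorant of the kernel min (2^n, 1 / d): the scales k for which
    d <= 2^-k contribute 2^k each. *)
Lemma dyadic_kernel_le (R : realFieldType) (d x : R) (k0 n : nat) :
  0 <= d -> (k0 <= n)%N -> x <= 2 ^+ n -> x * d <= 1 ->
  x <= 2 ^+ k0 + \sum_(k0 <= k < n) 2 ^+ k * (d <= 2^-1 ^+ k)%R%:R.
Proof.
move=> d0 /subnK <-; elim: (n - k0)%N x => [|m IH] x.
  by rewrite add0n big_geq ?addr0.
rewrite addSn => xn xd; rewrite big_nat_recr ?leq_addl//= addrA.
have [xm|xm] := leP x (2 ^+ (m + k0)).
  by apply: le_trans (IH _ xm xd) _; rewrite lerDl mulr_ge0// exprn_ge0.
have xd' : 2 ^+ (m + k0) * d <= 1 by apply: le_trans xd; rewrite ler_wpM2r// ltW.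
have -> : d <= 2^-1 ^+ (m + k0).
  by rewrite exprVn -[leRHS]mul1r ler_pdivlMr ?exprn_gt0// mulrC.
apply: le_trans xn _; rewrite mulr1 exprS mulr_natl mulr2n lerD2r.
exact: IH.
Qed.

Lemma geometric_sum_le (R : realFieldType) (r : R) (k0 n : nat) :
  0 <= r < 1 -> \sum_(k0 <= k < n) r ^+ k <= (1 - r)^-1.
Proof.
move=> /andP[r0 r1]; have r1' : 0 < 1 - r by rewrite subr_gt0.
rewrite -[leRHS]mul1r ler_pdivlMr//.
have [kn|nk] := leqP k0 n; last by rewrite big_geq ?mul0r// ltnW.
suff -> : (\sum_(k0 <= k < n) r ^+ k) * (1 - r) = r ^+ k0 - r ^+ n.
  have := exprn_ile1 k0 r0 (ltW r1); have := exprn_ge0 n r0; lra.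
rewrite -(subnK kn); elim: (n - k0)%N => [|m IH].
  by rewrite add0n big_geq// mul0r subrr.
by rewrite addSn big_nat_recr ?leq_addl//= mulrDl IH exprS; ring.
Qed.

(** The potential of the weights for the truncated kernel 1 / d, summed over
    dyadic annuli: the ball of radius 2^-k contributes 2^k b^k, and the series
    converges because 2 b < 1. *)
Lemma frostman_potential_le (R : realFieldType) (N : nat) (d w x : 'I_N -> R) (b : R)
    (k0 n : nat) :
  (forall j, 0 <= d j) -> (forall j, 0 <= w j) -> 0 <= b -> 2 * b < 1 ->
  (k0 <= n)%N ->
  (forall k, (k0 <= k <= n)%N -> \sum_(j | d j <= 2^-1 ^+ k) w j <= b ^+ k) ->
  (forall j, x j <= 2 ^+ n) -> (forall j, x j * d j <= 1) ->
  \sum_j w j * x j <= 2 ^+ k0 * \sum_j w j + (1 - 2 * b)^-1.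
Proof.
move=> d0 w0 b0 b1 kn wb xn xd.
apply: (@le_trans _ _ (\sum_j w j *
    (2 ^+ k0 + \sum_(k0 <= k < n) 2 ^+ k * (d j <= 2^-1 ^+ k)%R%:R))).
  by apply: ler_sum => j _; rewrite ler_wpM2l// dyadic_kernel_le.
under eq_bigr do rewrite mulrDr mulrC mulr_sumr.
rewrite big_split/= -mulr_sumr lerD2l exchange_big/=.
apply: le_trans (geometric_sum_le _ (2 * b) k0 n _); last by rewrite b1 mulr_ge0.
rewrite big_nat_cond [leRHS]big_nat_cond; apply: ler_sum => k; rewrite andbT => /andP[k0k kn'].
rewrite exprMn; apply: le_trans (_ : _ <= 2 ^+ k * \sum_(j | d j <= 2^-1 ^+ k) w j) _.
  rewrite mulr_sumr [leRHS]big_mkcond; apply: ler_sum => j _.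
  by case: ifP => _; rewrite ?mulr1 ?mulr0// mulrC.
by rewrite ler_pM2l ?exprn_gt0// wb// k0k ltnW.
Qed.

(** The capacities 2^-(ks) of Frostman's condition beat the growth 2^k of the
    kernel exactly because s > 1. *)
Lemma half_powR_lt (R : realType) (s : R) : 1 < s -> 2 * 2^-1 `^ s < 1.
Proof.
move=> s1; rewrite -mulr_powRB1 ?invr_ge0 ?(lt_trans ltr01)// mulrA mulfV// mul1r.
have s10 : 0 < s - 1 by rewrite subr_gt0.
have h : 2^-1 < 1 :> R by rewrite invf_lt1 ?ltr1n.
by have := gt0_ltr_powR s10 _ _ h; rewrite powR1; apply; rewrite nnegrE.
Qed.

(** The constant c does not depend on the scale 2^-n, which is what makes the
    passage to the limit possible. *)
Lemma lebesgue2_thickened_sum_ge (R : realType) (K : set R) (E : set (R * R))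
    (s : R) (k0 : nat) :
  measurable K -> K `<=` `[1, 2]%classic -> (0 < lebesgue_measure K)%E ->
  compact E -> 1 < s -> (0 < hausdorff_delta s (16 * 2^-1 ^+ k0) E)%E ->
  exists2 c : R, 0 < c & forall n (S : set (R * R)), (k0 <= n)%N -> measurable S ->
    (forall p, E p -> parabola_piece K (2^-1 ^+ n) p `<=` S) ->
    (c%:E <= lebesgue2 S)%E.
Proof.
move=> mK K12 K0 cE s1 HE.
have [l [l0 lK]] : exists l : R, 0 < l /\ lebesgue_measure K = l%:E.
  have Kfin : lebesgue_measure K \is a fin_num.
    rewrite ge0_fin_numE//.
    apply: (@le_lt_trans _ _ (lebesgue_measure `[1%R, 2%R]%classic)).
      by apply: le_measure; rewrite ?inE.
    by rewrite lebesgue_measure_itv/=; case: ifP => _; rewrite -?EFinB ltry.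
  by exists (fine (lebesgue_measure K)); rewrite fineK// -lte_fin fineK.
pose b : R := 2^-1 `^ s.
have b0 : 0 <= b by exact: powR_ge0.
have b1 : 2 * b < 1 by exact: half_powR_lt.
have [eta eta0 HE'] : exists2 eta : R, 0 < eta &
    (eta%:E <= hausdorff_delta s (16 * 2^-1 ^+ k0) E)%E.
  move: HE; case: (hausdorff_delta _ _ _) => [r|_|//]; last by exists 1; rewrite ?leey.
  by rewrite lte_fin => r0; exists r.
pose G := (1 - 2 * b)^-1.
have G0 : 0 < G by rewrite invr_gt0 subr_gt0.
pose m0 := eta / 16 `^ s.
have m00 : 0 < m0 by rewrite divr_gt0// powR_gt0.
exists (l ^+ 2 * m0 / (8 * (2 ^+ k0 * m0 + G))).
  rewrite divr_gt0// ?mulr_gt0 ?exprn_gt0// addr_gt0// mulr_gt0// exprn_gt0//.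
move=> n S kn mS ES.
have [->|Sfin] := eqVneq (lebesgue2 S) +oo%E; first by rewrite leey.
have [N [p [w [Ep w0 wb wE]]]] := discrete_frostman _ _ s _ _ cE (ltW (lt_trans ltr01 s1)) kn.
set M := \sum_i w i in wE.
have M0 : m0 <= M.
  rewrite /m0 ler_pdivrMr ?powR_gt0// mulrC -lee_fin.
  exact: le_trans HE' wE.
pose d : R := 2^-1 ^+ n.
have d0 : 0 < d by rewrite exprn_gt0.
(* x i j stands for min (1, 16 d / |p i - p j|). *)
have [x xP] : exists x : 'I_N -> 'I_N -> R, forall i j,
   [/\ 0 <= x i j, x i j <= 1, x i j * `|p i - p j| <= 16 * d &
    (lebesgue2 (parabola_piece K d (p i) `&` parabola_piece K d (p j)) <=
     (2 * d * x i j)%:E)%E].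
  have h i j := parabola_piece_overlap _ _ _ (p i) (p j) mK K12 d0.
  by exists (fun i j => sval (cid (h i j))) => i j; case: (cid (h i j)).
pose Q := 2 ^+ k0 * M + G.
have Q0 : 0 < Q.
  by rewrite addr_gt0// mulr_gt0 ?exprn_gt0// (lt_le_trans m00).
have row i : \sum_j w j * x i j <= 16 * d * Q.
  have := @frostman_potential_le _ N (fun j => `|p i - p j|) w
    (fun j => x i j / (16 * d)) b k0 n.
  have d16 : 0 < 16 * d by rewrite mulr_gt0.
  rewrite -/M -/Q => /(_ _ w0 b0 b1 kn (wb i)) h.
  rewrite mulrC -ler_pdivrMr// mulr_suml.
  under eq_bigr do rewrite -mulrA.
  apply: h => [j|j|j]; first exact: normr_ge0.
    have [_ x1 _ _] := xP i j; rewrite ler_pdivrMr// (le_trans x1)//.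
    by rewrite mulrCA /d -exprMn mulfV// expr1n mulr1 ler1n.
  by have [_ _ xd _] := xP i j; rewrite mulrAC ler_pdivrMr// mul1r.
(* The value t = a d in second_moment_le: it makes the left-hand side twice the
   bound of the double sum, so that t^2 |S| has to compensate for the rest. *)
pose a := 16 * Q / l.
have a0 : 0 < a by rewrite divr_gt0// mulr_gt0.
have t0 : 0 <= a * d by rewrite mulr_ge0// ltW.
have h : (\sum_i (2 * (a * d) * w i)%:E * lebesgue2 (parabola_piece K d (p i)) <=
    \sum_i \sum_j (w i * w j)%:E *
      lebesgue2 (parabola_piece K d (p i) `&` parabola_piece K d (p j)) +
    ((a * d) ^+ 2)%:E * lebesgue2 S)%E.
  apply: (second_moment_le _ _ _ (@lebesgue2 R)) => // i.
  - exact: measurable_parabola_piece.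
  - exact: ES (Ep i).
have [mu mu0 muE] : exists2 mu, 0 <= mu & lebesgue2 S = mu%:E.
  have : lebesgue2 S \is a fin_num by rewrite ge0_fin_numE ?lebesgue2_ge0// ltey.
  move=> /fineK <-; exists (fine (lebesgue2 S)) => //.
  by apply: fine_ge0; exact: lebesgue2_ge0.
rewrite muE in h *.
move: h; under eq_bigr do rewrite lebesgue2_parabola_piece ?ltW// lK -!EFinM.
rewrite sumEFin => h.
have {}h : \sum_i 2 * (a * d) * w i * (2 * d * l) <=
    \sum_i \sum_j w i * w j * (2 * d * x i j) + (a * d) ^+ 2 * mu.
  rewrite -lee_fin; apply: le_trans h _; rewrite EFinD EFinM leeD2r//.
  rewrite -sumEFin; apply: lee_sum => i _; rewrite -sumEFin; apply: lee_sum => j _.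
  rewrite (EFinM (w i * w j)); apply: lee_wpmul2l; first by rewrite lee_fin mulr_ge0.
  by have [] := xP i j.
have h1 : \sum_i 2 * (a * d) * w i * (2 * d * l) = 4 * a * d ^+ 2 * l * M.
  by rewrite mulr_sumr; apply: eq_bigr => i _; ring.
have h2 : \sum_i \sum_j w i * w j * (2 * d * x i j) <= 32 * d ^+ 2 * Q * M.
  rewrite mulr_sumr; apply: ler_sum => i _.
  rewrite (eq_bigr (fun j => 2 * d * w i * (w j * x i j))); last by move=> j _; ring.
  rewrite -mulr_sumr.
  rewrite (_ : 32 * _ * _ * _ = 2 * d * w i * (16 * d * Q)); last by ring.
  by rewrite ler_wpM2l// mulr_ge0// mulr_ge0// ltW.
have h3 : 32 * Q * M <= a ^+ 2 * mu.
  have d20 : 0 < d ^+ 2 by rewrite exprn_gt0.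
  rewrite -(ler_pM2l d20); move: h; rewrite h1.
  have -> : 4 * a * d ^+ 2 * l * M = d ^+ 2 * (64 * Q * M).
    by rewrite /a; field; rewrite gt_eqF.
  by rewrite exprMn; lra.
have h4 : l ^+ 2 * M / (8 * Q) <= mu.
  rewrite ler_pdivrMr ?mulr_gt0//.
  have l20 : 0 < l ^+ 2 by rewrite exprn_gt0.
  have Q20 : 0 < 32 * Q by rewrite mulr_gt0.
  have h3' : l ^+ 2 * (32 * Q * M) <= l ^+ 2 * (a ^+ 2 * mu) by rewrite ler_pM2l.
  rewrite -(ler_pM2l Q20) (_ : 32 * Q * (mu * (8 * Q)) = l ^+ 2 * (a ^+ 2 * mu)).
    by apply: le_trans h3'; rewrite le_eqVlt; apply/orP; left; apply/eqP; ring.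
  by rewrite /a; field; rewrite gt_eqF.
rewrite lee_fin; apply: le_trans h4.
have l20 : 0 < l ^+ 2 by rewrite exprn_gt0.
have q0 : 0 < 2 ^+ k0 * m0 + G by rewrite addr_gt0// mulr_gt0// exprn_gt0.
rewrite ler_pdivrMr ?mulr_gt0// [leRHS]mulrAC ler_pdivlMr ?mulr_gt0//.
rewrite (_ : _ * (8 * Q) = 8 * l ^+ 2 * (m0 * Q)); last by ring.
rewrite [leRHS](_ : _ = 8 * l ^+ 2 * (M * (2 ^+ k0 * m0 + G))); last by ring.
rewrite ler_pM2l ?mulr_gt0// /Q.
have : G * m0 <= G * M by rewrite ler_pM2l.
by set u := 2 ^+ k0; lra.
Qed.

Lemma dimH_gt_hausdorff_gt0 (R : realType) (E : set (R * R)) :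
  (1 < dimH E)%E -> exists2 s : R, 1 < s & (0 < hausdorff s E)%E.
Proof.
move=> E1; have [s s1 sE] : exists2 s : R, 1 < s & (s%:E < dimH E)%E.
  move: E1; case: (dimH E) => [r||//]; last by exists 2; rewrite ?ltr1n ?ltry.
  by rewrite lte_fin => r1; exists ((1 + r) / 2); rewrite ?lte_fin; lra.
exists s => //; rewrite lt0e hausdorff_ge0 andbT; apply/eqP => E0.
suff : (dimH E <= s%:E)%E by rewrite leNgt sE.
by apply: ereal_inf_lbound; exists s => //; split=> //; lra.
Qed.

Lemma hausdorff_delta_dyadic_gt0 (R : realType) (E : set (R * R)) (s : R) :
  (0 < hausdorff s E)%E ->
  exists k0, (0 < hausdorff_delta s (16 * 2^-1 ^+ k0) E)%E.
Proof.
move=> /ereal_sup_gt[_ [d /= d0 <-] Ed].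
have [k kd] := exists_half_expr_le _ _ (divr_gt0 d0 (ltr0n R 16)).
exists k; apply: lt_le_trans Ed _; apply: hausdorff_delta_decr; lra.
Qed.

(** The closed neighbourhoods of radius 2^-n of the compact set E + G decrease to
    E + G, and each of them contains the translates by E of the parabola piece
    above K, thickened by 2^-n. *)
Lemma lebesgue2_minkowski_sum_gt0 (R : realType) (K : set R) (E G : set (R * R)) :
  measurable K -> K `<=` `[1, 2]%classic -> (0 < lebesgue_measure K)%E ->
  compact E -> compact G -> (forall k, K k -> G (k, k ^+ 2 / 2)) ->
  (1 < dimH E)%E -> (0 < lebesgue2 (minkowski_sum E G))%E.
Proof.
move=> mK K12 K0 cE cG KG /dimH_gt_hausdorff_gt0[s s1].
move=> /hausdorff_delta_dyadic_gt0[k0 HE].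
have [c c0 cS] := lebesgue2_thickened_sum_ge _ _ _ _ _ mK K12 K0 cE s1 HE.
apply: lt_le_trans (_ : (c%:E <= _)%E); first by rewrite lte_fin.
pose C := minkowski_sum E G.
have cC : compact C by exact: compact_minkowski_sum.
pose Q n : set (R * R) :=
  `[- 2^-1 ^+ n, 2^-1 ^+ n]%classic `*` `[- 2^-1 ^+ n, 2^-1 ^+ n]%classic.
pose S n := minkowski_sum C (Q n).
have cS' n : compact (S n).
  by apply: compact_minkowski_sum => //; apply: compact_setX; exact: segment_compact.
have mS n : measurable (S n) by exact: compact_measurable2.
have SC : \bigcap_n S n = C by exact: bigcap_thickening.
have ndS : {homo S : n m / (n <= m)%N >-> (m <= n)%O}.
  move=> n m nm; apply/subsetPset => _ [x Cx [y [y1 y2] <-]].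
  exists x => //; exists y => //.
  have h : 2^-1 ^+ m <= 2^-1 ^+ n :> R.
    by apply: ler_wiXn2l => //; rewrite invf_le1 ?ler1n.
  by split; move: y1 y2; rewrite /Q/= !in_itv/=; lra.
have cvg : lebesgue2 (S n) @[n --> \oo] --> lebesgue2 C.
  rewrite -SC; apply: (@nonincreasing_cvg_mu _ _ _ (@lebesgue2 R)) => //.
  - exact: compact_lebesgue2_lty.
  - by rewrite SC; exact: compact_measurable2.
rewrite -/C -(cvg_lim _ cvg)//; apply: lime_ge; first by apply/cvg_ex; exists (lebesgue2 C).
near=> n; apply: cS; [by near: n; exact: nbhs_infty_ge|exact: mS|].
move=> p Ep y [/KG Gy yp].
exists (p + (y.1 - p.1, (y.1 - p.1) ^+ 2 / 2)).
  by exists p => //; exists (y.1 - p.1, (y.1 - p.1) ^+ 2 / 2).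
exists (0, y.2 - (p.2 + (y.1 - p.1) ^+ 2 / 2)).
  by rewrite /Q; split; rewrite /= in_itv/= ?oppr_le0 ?exprn_ge0// -ler_norml.
by rewrite [RHS]surjective_pairing; congr pair => /=; ring.
Unshelve. all: by end_near. Qed.

(** * Envelopes of tangents to the parabola *)

(** Remove from [1, 2] an open neighbourhood of the rationals of measure less
    than 1. *)
Lemma fat_compact_without_rationals (R : realType) : exists K : set R,
  [/\ compact K, K `<=` `[1, 2]%classic, (0 < lebesgue_measure K)%E &
    forall q : rat, ~ K (ratr q)].
Proof.
pose Q := range (@ratr R : rat -> R).
have cQ : countable Q by apply: (sub_countable (card_image_le _ _)); exact: countableP.
have mQ : measurable Q by exact: countable_measurable.
have Q0 : lebesgue_measure Q = 0%E by exact: countable_lebesgue_measure0.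
have [||U [oU QU UQ]] := @lebesgue_regularity_outer R Q 2^-1 mQ _ _.
- by rewrite [X in (X < _)%E]Q0 ltry.
- by rewrite invr_gt0.
have mU : measurable U by exact: open_measurable.
have U1 : (lebesgue_measure U < 1)%E.
  rewrite -(setDUK QU); apply: le_lt_trans (measureU2 _ _ _) _ => //.
    exact: measurableD.
  rewrite [X in (X + _)%E]Q0 add0e; apply: lt_trans UQ _.
  by rewrite lte_fin invf_lt1 ?ltr1n.
exists (`[1, 2]%classic `\` U); split.
- apply: (subclosed_compact _ (@segment_compact R 1 2)); last exact: subDsetl.
  by rewrite setDE; apply: closedI; [exact: interval_closed|exact: open_closedC].
- exact: subDsetl.
- rewrite ltNge; apply/negP => K0.
  have : (lebesgue_measure `[1%R, 2%R]%classic <=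
      lebesgue_measure (`[1%R, 2%R]%classic `\` U) + lebesgue_measure U)%E.
    apply: le_trans (measureU2 _ _ _) => //; last exact: measurableD.
    apply: le_measure; rewrite ?inE//; first by apply: measurableU => //; exact: measurableD.
    by move=> x x12; have [Ux|Ux] := pselect (U x); [right|left].
  rewrite lebesgue_measure_itv/= lte_fin ltr1n/= -EFinB.
  rewrite (_ : 2 - 1 = 1); last by ring.
  move=> h; have := le_lt_trans h (le_lt_trans (leeD2r _ K0) _).
  by rewrite add0e => /(_ _ U1); rewrite ltxx.
- by move=> q [_]; apply; apply: QU; exists q.
Qed.

(** The function g is the upper envelope of the tangents k x - k^2 / 2 at the
    abscissas k in K.  Equivalently 2 g(x) = x^2 - dist(x, K)^2. *)
Definition tangent_envelope {R : realType} (K : set R) (g : R -> R) : Prop :=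
  (forall k x, K k -> k * x - k ^+ 2 / 2 <= g x) /\
  (forall x, exists2 k, K k & g x = k * x - k ^+ 2 / 2).

Lemma tangent_envelope_exists (R : realType) (K : set R) :
  compact K -> K !=set0 -> exists g, tangent_envelope K g.
Proof.
move=> cK K0.
have h x : exists k, K k /\ forall k', K k' -> k' * x - k' ^+ 2 / 2 <= k * x - k ^+ 2 / 2.
  have [|k] := @compact_EVT_max R R (fun k : R => k * x - k ^+ 2 / 2) K K0 cK.
    apply: continuous_subspaceT => k; apply: cvgB; first exact: mulrr_continuous.
    by apply: cvgM; [exact: exprn_continuous|exact: cvg_cst].
  by rewrite inE => Kk km; exists k; split => // k' Kk'; apply: km; rewrite inE.
have [f fP] := choice h.
exists (fun x => f x * x - f x ^+ 2 / 2); split=> [k x Kk|x]; first exact: (fP x).2.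
by exists (f x) => //; exact: (fP x).1.
Qed.

Lemma tangent_envelope_convex (R : realType) (K : set R) (g : R -> R) (D : set R) :
  tangent_envelope K g -> convex_function (D : set R) g.
Proof.
move=> [gge gex] t x y _ _; rewrite convRE [X in g X <= _]convRE.
set u := t%:num; rewrite -[unstable.onem _]/(1 - u).
have u0 : 0 <= u by rewrite /u.
have u1 : u <= 1 by rewrite /u.
have [k Kk ->] := gex (u * x + (1 - u) * y).
have h1 : u * (k * x - k ^+ 2 / 2) <= u * g x by rewrite ler_wpM2l// gge.
have h2 : (1 - u) * (k * y - k ^+ 2 / 2) <= (1 - u) * g y.
  by rewrite ler_wpM2l ?gge// subr_ge0.
by apply: le_trans (lerD h1 h2); rewrite le_eqVlt; apply/orP; left; apply/eqP; field.
Qed.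

Lemma tangent_envelope_lip (R : realType) (K : set R) (g : R -> R) x y :
  K `<=` `[1, 2]%classic -> tangent_envelope K g -> `|g x - g y| <= 2 * `|x - y|.
Proof.
move=> K12 [gge gex].
have h a b : g a - g b <= 2 * `|a - b|.
  have [k Kk ->] := gex a; have := gge _ b Kk.
  have := K12 _ Kk; rewrite /= in_itv/= => /andP[k1 k2].
  have : k * (a - b) <= 2 * `|a - b|.
    apply: le_trans (ler_norm _) _; rewrite normrM ler_wpM2r// ger0_norm//; lra.
  by lra.
by rewrite ler_norml h andbT; have := h y x; rewrite distrC; lra.
Qed.

(** Every tangent lies below the parabola, and the one at k touches it at k. *)
Lemma tangent_envelope_contact (R : realType) (K : set R) (g : R -> R) k :
  tangent_envelope K g -> K k -> g k = k ^+ 2 / 2.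
Proof.
move=> [gge gex] Kk; have := gge _ k Kk; have [k' _ ->] := gex k.
by have := sqr_ge0 (k - k'); nra.
Qed.

(** If the tangent at k0 realises the supremum at q, then it dominates every
    other tangent at q, and also at k0, where it touches the parabola; two affine
    functions that are ordered at both ends of a segment are ordered on it. *)
Lemma tangent_envelope_flat (R : realType) (K : set R) (g : R -> R) q :
  tangent_envelope K g -> ~ K q ->
  exists k0, k0 != q /\ forall t, 0 <= t <= 1 ->
    g (q + t * (k0 - q)) = k0 * (q + t * (k0 - q)) - k0 ^+ 2 / 2.
Proof.
move=> [gge gex] Kq; have [k0 Kk0 gq] := gex q.
exists k0; split; first by apply/eqP => kq; apply: Kq; rewrite -kq.
move=> t /andP[t0 t1]; set x := q + _; apply/eqP; rewrite eq_le gge// andbT.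
have [k Kk ->] := gex x; have := gge _ q Kk; rewrite gq => h.
have h1 : 0 <= (1 - t) * (k0 * q - k0 ^+ 2 / 2 - (k * q - k ^+ 2 / 2)).
  by rewrite mulr_ge0 ?subr_ge0.
have h2 : 0 <= t * ((k - k0) ^+ 2 / 2) by rewrite mulr_ge0 ?divr_ge0 ?sqr_ge0.
rewrite -subr_ge0; apply: le_trans (addr_ge0 h1 h2) _.
by rewrite le_eqVlt; apply/orP; left; apply/eqP; rewrite /x; field.
Qed.

(** * Lower and upper bounds for Hausdorff measures *)

(** The parametrisation g of a set A has an inverse that is Holder of exponent
    s, so a cover of A by sets of diameters r_k induces a cover of [a, b] by
    intervals of length 2 C r_k^s. *)
Lemma hausdorff_holder_ge (R : realType) (s C a b : R) (g : R -> R * R) :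
  0 <= s -> 0 < C -> a <= b ->
  (forall x y, a <= x <= b -> a <= y <= b -> `|x - y| <= C * enorm (g x - g y) `^ s) ->
  (((b - a) / (2 * C))%:E <= hausdorff s (g @` `[a, b]%classic))%E.
Proof.
move=> s0 C0 ab gC.
apply: le_trans (hausdorff_delta_le_hausdorff s _ (ltr01 : 0 < 1 :> R)).
apply: le_ereal_inf_tmp => _ [F [cF dF] <-].
have C20 : 0 < 2 * C by rewrite mulr_gt0.
have h k : exists I : set R, [/\ measurable I,
    (forall x, a <= x <= b -> F k (g x) -> I x) &
    (lebesgue_measure I <= (2 * C)%:E * hausdorff_gauge s (F k))%E].
  have [[x [xab Fx]]|nx] := pselect (exists x, a <= x <= b /\ F k (g x)); last first.
    exists set0; split=> // [x xab Fx|]; first by apply: nx; exists x.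
    by rewrite measure0 mule_ge0// ?hausdorff_gauge_ge0// lee_fin ltW.
  have ub y z : F k y -> F k z -> ((enorm (y - z))%:E <= ediam (F k))%E.
    by move=> Fy Fz; apply: ereal_sup_ubound; exists (y, z).
  have d0 : (0 <= ediam (F k))%E.
    apply: le_trans (ub _ _ Fx Fx); rewrite lee_fin; exact: sqrtr_ge0.
  have [r r0 dr] : exists2 r : R, 0 <= r & ediam (F k) = r%:E.
    have : ediam (F k) \is a fin_num.
      by rewrite ge0_fin_numE//; apply: le_lt_trans (dF k) (ltry _).
    by move=> /fineK <-; exists (fine (ediam (F k))) => //; exact: fine_ge0.
  pose D := C * r `^ s; have D0 : 0 <= D by rewrite mulr_ge0 ?powR_ge0// ltW.
  exists [set t | `|t - x| <= D]; split.
  - rewrite [X in measurable X](_ : _ = `[x - D, x + D]%classic)//.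
    by apply/seteqP; split => t /=; rewrite in_itv/= ler_distl.
  - move=> y yab Fy /=; apply: le_trans (gC _ _ yab xab) _.
    rewrite ler_pM2l//; apply: ge0_ler_powR => //; rewrite ?nnegrE ?sqrtr_ge0//.
    by rewrite -lee_fin -dr ub.
  - rewrite lebesgue_measure_segment// /hausdorff_gauge.
    case: eqP => [F0|_]; first by move: Fx; rewrite F0.
    by rewrite dr poweR_EFin -EFinM /D mulrA.
pose I k := sval (cid (h k)).
have IP k : [/\ measurable (I k), (forall x, a <= x <= b -> F k (g x) -> I k x) &
    (lebesgue_measure (I k) <= (2 * C)%:E * hausdorff_gauge s (F k))%E].
  by rewrite /I; case: cid.
rewrite EFinM lee_pdivrMr// muleC -nneseriesZl//; last first.
  by move=> k _; exact: hausdorff_gauge_ge0.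
have -> : ((b - a)%:E = lebesgue_measure `[a, b]%classic)%E.
  rewrite lebesgue_measure_itv/= lte_fin; case: ltP => // ba.
  by rewrite (_ : a = b) ?subrr//; apply: le_anti; rewrite ab.
apply: (@le_trans _ _ (\sum_(k <oo) lebesgue_measure (I k))%E).
  apply: measure_sigma_subadditive => //; first by move=> k; have [] := IP k.
  move=> x; rewrite /= in_itv/= => xab.
  have [|k _ Fk] := cF (g x); first by exists x => //=; rewrite in_itv.
  by exists k => //; have [_ + _] := IP k; apply.
by apply: lee_nneseries => k _ //; have [] := IP k.
Qed.

(** Cut [1, 2] into 2^k intervals; the corresponding pieces of the graph have
    diameter at most 8 / 2^k, because g is 2-Lipschitz. *)
Lemma hausdorff1_graph_le (R : realType) (g : R -> R) :
  (forall x y, `|g x - g y| <= 2 * `|x - y|) ->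
  (hausdorff 1 (graph_on g `[1%R, 2%R]%classic) <= 16%:E)%E.
Proof.
move=> glip; apply: ge_ereal_sup => _ [d /= d0 <-].
have [k kd] := exists_half_expr_le _ _ (divr_gt0 d0 (ltr0n R 8)).
pose N := (2 ^ k)%N; pose e : R := 2^-1 ^+ k.
have e0 : 0 < e by rewrite exprn_gt0.
have Ne : N%:R * e = 1 by rewrite /e natrX exprVn mulfV// gt_eqF// exprn_gt0.
pose F i := [set y : R * R | y.2 = g y.1 /\ `|y.1 - (1 + i%:R * e)| <= e].
have dF i : (ediam (F i) <= (8 * e)%:E)%E.
  rewrite (_ : 8 * e = 2 * (4 * e)); last by ring.
  apply: ediam_le => x y [x2 x1] [y2 y1].
  have xy : `|x.1 - y.1| <= 2 * e.
    apply: le_trans (ler_distD (1 + i%:R * e) _ _) _.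
    by rewrite (distrC _ y.1); lra.
  rewrite prod_normE/= x2 y2 ge_max; apply/andP; split; first by lra.
  by apply: le_trans (glip _ _) _; lra.
apply: le_trans (hausdorff_delta_finite_cover _ _ _ _ [seq F i | i <- iota 0 N.+1] _ _) _.
- move=> _ [x x12 <-].
  have /andP[x1 x2] : 1 <= x <= 2 by move: x12; rewrite /= in_itv.
  have y0 : 0 <= (x - 1) * N%:R by rewrite mulr_ge0// subr_ge0.
  exists (F (Num.truncn ((x - 1) * N%:R))).
    apply: map_f; rewrite mem_iota/= add0n ltnS.
    rewrite -(ler_nat R); have /andP[h _] := truncn_itv y0.
    by apply: le_trans h _; rewrite ler_piMl//; lra.
  split=> //=.
  have := truncn_itv y0; set i := Num.truncn _ => /andP[h1 h2].
  have xE : x - 1 = (x - 1) * N%:R * e by rewrite -mulrA Ne mulr1.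
  have h1' : i%:R * e <= x - 1 by rewrite [leRHS]xE ler_pM2r.
  have h2' : x - 1 < i%:R * e + e.
    by rewrite [ltLHS]xE -[X in _ < _ + X]mul1r -mulrDl ltr_pM2r// natr1.
  by rewrite ler_norml; lra.
- move=> X /mapP[i _ ->]; apply: le_trans (dF i) _.
  by rewrite lee_fin; move: kd; rewrite -/e; lra.
rewrite big_map; apply: (@le_trans _ _ (\sum_(i <- iota 0 N.+1) (8 * e)%:E)%E).
  have e80 : 0 <= 8 * e by rewrite mulr_ge0// ltW.
  apply: lee_sum => i _; rewrite -[X in (_ <= X%:E)%E](powRr1 e80).
  exact: hausdorff_gauge_le.
rewrite sumEFin lee_fin big_const_seq count_predT size_iota iter_addr addr0.
have e1 : e <= 1 by rewrite exprn_ile1// invf_le1 ?ler1n.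
have -> : 8 * e *+ N.+1 = 8 * (N%:R * e) + 8 * e.
  by rewrite -mulr_natr -natr1; ring.
by rewrite Ne; lra.
Qed.

Lemma hausdorff1_graph_ge (R : realType) (g : R -> R) (a b : R) : a <= b ->
  (((b - a) / 2)%:E <= hausdorff 1 (graph_on g `[a, b]%classic))%E.
Proof.
move=> ab.
have := @hausdorff_holder_ge R 1 1 a b (fun x => (x, g x)) ler01 ltr01 ab.
rewrite mulr1; apply=> x y _ _; rewrite mul1r powRr1 ?sqrtr_ge0//.
exact: (le_enorm ((x, g x) - (y, g y))).1.
Qed.

(** * Symmetric Cantor sets *)

(** The sum of the terms (1 - r) r^i over those i < n for which the i-th binary
    digit of x is 1; as n grows these are the partial sums of the map from
    binary expansions to the Cantor set of ratio r. *)
Fixpoint digit_sum {R : realType} (r : R) (n : nat) (x : R) : R :=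
  if n is m.+1 then
    if x < 2^-1 then r * digit_sum r m (2 * x)
    else 1 - r + r * digit_sum r m (2 * x - 1)
  else 0.

(** The left endpoints of the 2^n intervals of length r^n at stage n of the
    construction of the Cantor set of ratio r. *)
Fixpoint cantor_endpoints {R : realType} (r : R) (n : nat) : seq R :=
  if n is m.+1 then
    [seq r * v | v <- cantor_endpoints r m] ++
    [seq 1 - r + r * v | v <- cantor_endpoints r m]
  else [:: 0].

Definition cantor_dust {R : realType} (r : R) : set R :=
  \bigcap_n \bigcup_(v in [set` cantor_endpoints r n]) `[v, v + r ^+ n]%classic.

Section cantor_dust.
Context {R : realType} (r : R) (r_gt0 : 0 < r) (r_half : 2 * r < 1).

Local Notation F := (digit_sum r).

Let r_ge0 : 0 <= r := ltW r_gt0.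

Lemma digit_sum_itv n x : 0 <= F n x <= 1.
Proof.
have [r0 r2] := (r_gt0, r_half).
elim: n x => [|n IH] x; first by rewrite lexx ler01.
have rF y : 0 <= r * F n y <= r.
  by have /andP[h0 h1] := IH y; rewrite mulr_ge0//= ler_piMr.
rewrite /=; case: ifP => _; first by have /andP[] := rF (2 * x); lra.
by have /andP[] := rF (2 * x - 1); lra.
Qed.

Lemma digit_sum_leS n x : F n x <= F n.+1 x.
Proof.
elim: n x => [|n IH] x; first by have /andP[] := digit_sum_itv 1 x.
rewrite /=; case: ifP => _; first by rewrite ler_pM2l//; exact: IH.
by rewrite lerD2l ler_pM2l//; exact: IH.
Qed.

Lemma digit_sum_le m n x : (m <= n)%N -> F m x <= F n x.
Proof.
move=> /subnK <-; elim: (n - m)%N => [|k IH]; first by rewrite add0n.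
by rewrite addSn (le_trans IH)// digit_sum_leS.
Qed.

Lemma digit_sum_tail n m x : F (n + m) x <= F n x + r ^+ n.
Proof.
elim: n x => [|n IH] x; first by rewrite !add0n/= add0r; have /andP[] := digit_sum_itv m x.
rewrite addSn /= exprS; case: ifP => _; first by rewrite -mulrDr ler_pM2l//; exact: IH.
by rewrite -[leRHS]addrA -mulrDr lerD2l ler_pM2l//; exact: IH.
Qed.

(** Points at distance at least 2^-n differ in one of their first n binary
    digits; at the first such digit their images fall on the two sides of a gap. *)
Lemma digit_sum_separated n N x y : 0 <= x -> y < 1 -> 2^-1 ^+ n <= y - x ->
  (n <= N)%N -> (1 - 2 * r) * r ^+ n <= F N y - F N x.
Proof.
have [r0 r2] := (r_gt0, r_half).
elim: n N x y => [|n IH] [|N] x y x0 y1; rewrite ?expr0// ?exprS => yx nN; try lra.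
have yx2 : 2^-1 ^+ n <= 2 * (y - x).
  by rewrite -[leLHS](mulVKf (_ : 2 != 0 :> R))// ler_pM2l.
rewrite /=; case: ltP => y2; case: ltP => x2.
- have := IH N (2 * x) (2 * y); rewrite -mulrBr => h.
  have {}h : (1 - 2 * r) * r ^+ n <= F N (2 * y) - F N (2 * x).
    by apply: IH => //; rewrite ?mulr_ge0//; lra.
  by rewrite -mulrBr mulrCA ler_pM2l.
- have : 0 < 2^-1 ^+ n :> R by rewrite exprn_gt0.
  by move=> n0; exfalso; lra.
- have /andP[h0 _] := digit_sum_itv N (2 * y - 1).
  have /andP[_ h1] := digit_sum_itv N (2 * x).
  have rn : r ^+ n <= 1 by rewrite exprn_ile1//; lra.
  apply: (@le_trans _ _ (1 - 2 * r)).
    rewrite ler_piMr//; first by lra.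
    by rewrite mulr_ile1 ?exprn_ge0//; lra.
  have : 0 <= r * F N (2 * y - 1) by rewrite mulr_ge0.
  have : r * F N (2 * x) <= r by rewrite ler_piMr.
  by lra.
- have h : (1 - 2 * r) * r ^+ n <= F N (2 * y - 1) - F N (2 * x - 1).
    by apply: IH => //; lra.
  rewrite opprD addrACA subrr add0r -mulrBr mulrCA ler_pM2l//.
Qed.

Lemma digit_sum_endpoints n x : F n x \in cantor_endpoints r n.
Proof.
elim: n x => [|n IH] x; first by rewrite mem_head.
rewrite /= mem_cat; case: ifP => _; apply/orP; [left|right].
  exact: (map_f (fun v => r * v)).
exact: (map_f (fun v => 1 - r + r * v)).
Qed.

Lemma size_cantor_endpoints n : size (cantor_endpoints r n) = (2 ^ n)%N.
Proof. by elim: n => //= n IH; rewrite size_cat !size_map IH addnn expnS mul2n. Qed.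

(** The limit of the partial sums, as a supremum since they increase with n. *)
Definition dust_point x := sup (range (fun n => F n x)).

Lemma dust_point_itv n x : F n x <= dust_point x <= F n x + r ^+ n.
Proof.
have rn0 : 0 <= r ^+ n by rewrite exprn_ge0.
have ub m : F m x <= F n x + r ^+ n.
  have [mn|/ltnW nm] := leqP m n; last by rewrite -(subnKC nm) digit_sum_tail.
  by apply: le_trans (digit_sum_le _ _ _ mn) _; rewrite lerDl.
apply/andP; split.
  apply: ub_le_sup; last by exists n.
  by exists (F n x + r ^+ n) => _ [m _ <-].
apply: ge_sup; first by exists (F 0 x), 0%N.
by move=> _ [m _ <-].
Qed.

Lemma dust_point_separated n x y : 0 <= x -> y < 1 -> 2^-1 ^+ n <= y - x ->
  (1 - 2 * r) * r ^+ n <= dust_point y - dust_point x.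
Proof.
move=> x0 y1 yx; rewrite lerBrDl -lerBrDr; apply: ge_sup; first by exists (F 0 x), 0%N.
move=> _ [m _ <-]; rewrite lerBrDr -lerBrDl.
apply: (@le_trans _ _ (F (maxn m n) y - F (maxn m n) x)).
  by apply: digit_sum_separated => //; exact: leq_maxr.
apply: lerB; first by have /andP[] := dust_point_itv (maxn m n) y.
by apply: digit_sum_le; exact: leq_maxl.
Qed.

Lemma dust_point_in x : cantor_dust r (dust_point x).
Proof.
move=> n _; exists (F n x) => /=; first exact: digit_sum_endpoints.
by rewrite in_itv/= dust_point_itv.
Qed.

Lemma compact_cantor_dust : compact (cantor_dust r).
Proof.
apply: (subclosed_compact _ (@segment_compact R 0 1)).
  apply: closed_bigI => n _; rewrite bigcup_seq.
  by apply: closed_bigsetU => v _; exact: interval_closed.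
move=> x /(_ 0%N Logic.I)[v /=]; rewrite inE => /eqP->.
by rewrite add0r expr0.
Qed.

Lemma cantor_dust_null : lebesgue_measure (cantor_dust r) = 0%E.
Proof.
have mC : measurable (cantor_dust r).
  by apply: closed_measurable; apply: compact_closed => //; exact: compact_cantor_dust.
have le n : (lebesgue_measure (cantor_dust r) <= ((2 * r) ^+ n)%:E)%E.
  apply: (@le_trans _ _ (lebesgue_measure
      (\big[setU/set0]_(v <- cantor_endpoints r n) `[v, v + r ^+ n]%classic))).
    apply: le_measure; rewrite ?inE//; first by apply: bigsetU_measurable => v _.
    by move=> x /(_ n Logic.I); rewrite bigcup_seq.
  rewrite exprMn -natrX -size_cantor_endpoints.
  elim: (cantor_endpoints r n) => [|v s IH].
    by rewrite big_nil measure0 mul0r.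
  rewrite big_cons; apply: le_trans (measureU2 _ _ _) _ => //.
    by apply: bigsetU_measurable.
  rewrite /= -natr1 mulrDl mul1r addrC EFinD; apply: leeD => //.
  rewrite lebesgue_measure_itv/= lte_fin ltrDl exprn_gt0//= -EFinD.
  by rewrite addrAC subrr add0r.
apply/eqP; rewrite eq_le measure_ge0 andbT.
apply/lee_addgt0Pr => e e0; rewrite add0e.
have [|n ne] := exists_expr_le _ (2 * r) e _ e0; first by rewrite mulr_ge0.
by apply: le_trans (le n) _; rewrite lee_fin.
Qed.

End cantor_dust.

Lemma enorm_distC (R : realType) (x y : R * R) : enorm (x - y) = enorm (y - x).
Proof. by rewrite /enorm/= -(sqrrN (x.1 - y.1)) -(sqrrN (x.2 - y.2)) !opprB. Qed.

(** With r^s = 1/2, the n-th scale r^n of the Cantor set corresponds to the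
    scale 2^-n of the unit interval.  Smaller exponents s' are allowed because
    the Cantor set has diameter at most 1. *)
Lemma dust_point_holder (R : realType) (r s s' x y : R) :
  0 < r -> 2 * r < 1 -> r `^ s = 2^-1 -> 0 <= s -> 0 <= s' <= s ->
  0 <= x <= 2^-1 -> 0 <= y <= 2^-1 ->
  `|x - y| <= 2 / (1 - 2 * r) `^ s *
    enorm ((0, dust_point r x) - (0, dust_point r y)) `^ s'.
Proof.
move=> r0 r2 rs s0 /andP[s'0 s's]; wlog xy : x y / x <= y.
  move=> H hx hy; case: (leP x y) => [xy|/ltW yx]; first exact: H.
  by rewrite distrC enorm_distC; exact: H.
move=> /andP[x0 _] /andP[_ y1].
have e0 : 0 < 1 - 2 * r by rewrite subr_gt0.
have es0 : 0 < (1 - 2 * r) `^ s by rewrite powR_gt0.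
have [->|xny] := eqVneq x y.
  by rewrite !subrr normr0 mulr_ge0 ?powR_ge0// divr_ge0// ltW.
have yx0 : 0 < y - x by rewrite subr_gt0 lt_neqAle xny.
have ex : exists n, 2^-1 ^+ n <= y - x by exact: exists_half_expr_le.
(* The first dyadic scale below y - x has positive rank because y - x <= 1/2. *)
have [[|n] nyx nmin] := ex_minnP ex; first by exfalso; rewrite expr0 in nyx; lra.
have yxn : y - x <= 2 * 2^-1 ^+ n.+1.
  rewrite exprS mulrA mulfV// mul1r leNgt; apply/negP => /ltW/nmin.
  by rewrite ltnn.
have y1' : y < 1 by lra.
have := dust_point_separated _ r0 r2 _ _ _ x0 y1' nyx.
set D := dust_point r y - dust_point r x => hD.
have D0 : 0 < D by apply: lt_le_trans hD; rewrite mulr_gt0 ?exprn_gt0.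
have D1 : D <= 1.
  have := dust_point_itv _ r0 r2 0 y; have := dust_point_itv _ r0 r2 0 x.
  by rewrite expr0 add0r => /andP[h1 h2] /andP[h3 h4]; rewrite /D/=; move: h1 h4 => /=; lra.
have -> : enorm ((0, dust_point r x) - (0, dust_point r y)) = D.
  by rewrite /enorm/= subrr expr0n/= add0r sqrtr_sqr distrC ger0_norm// ltW.
rewrite distrC (ger0_norm (ltW yx0)); apply: le_trans yxn _.
rewrite -mulrA ler_pM2l// -rs -powR_exprn ?(ltW r0)// ler_pdivlMl//.
rewrite -powRM ?exprn_ge0 ?(ltW e0) ?(ltW r0)//; apply: (@le_trans _ _ (D `^ s)).
  apply: ge0_ler_powR => //; rewrite nnegrE; last exact: ltW.
  by rewrite mulr_ge0 ?exprn_ge0 ?(ltW e0) ?(ltW r0).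
by apply: ger_powR => //; rewrite D0.
Qed.

Lemma compact_pair_image (R : realType) (f g : R -> R) (K : set R) :
  continuous f -> continuous g -> compact K -> compact [set (f t, g t) | t in K].
Proof.
move=> cf cg cK; apply: continuous_compact => //; apply: continuous_subspaceT => t.
apply: (@cvg_pair _ _ _ _ (nbhs (f t)) (nbhs (g t))); [exact: cf|exact: cg].
Qed.

Definition vertical_copy {R : realType} (C : set R) : set (R * R) :=
  [set (0, c) | c in C].

(** If H^s' vanished for some s' < s, the Holder inverse of dust_point would
    carry this to the Lebesgue measure of [0, 1/2]. *)
Lemma dimH_cantor_dust (R : realType) (r s : R) :
  0 < r -> 2 * r < 1 -> 0 <= s -> r `^ s = 2^-1 ->
  (s%:E <= dimH (vertical_copy (cantor_dust r)))%E.
Proof.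
move=> r0 r2 s0 rs; apply: le_ereal_inf_tmp => _ [s' [s'0 Hs'] <-].
rewrite lee_fin leNgt; apply/negP => s's.
pose C := 2 / (1 - 2 * r) `^ s.
have C0 : 0 < C by rewrite divr_gt0// powR_gt0// subr_gt0.
have h2 : 0 <= 2^-1 :> R by [].
have := @hausdorff_holder_ge R s' C 0 2^-1 (fun x => (0, dust_point r x)) s'0 C0 h2.
have sub : [set (0 : R, dust_point r x) | x in `[0, 2^-1]%classic] `<=`
    vertical_copy (cantor_dust r).
  by move=> _ [x _ <-]; exists (dust_point r x) => //; exact: dust_point_in.
move=> H; have {}H : (((2^-1 - 0) / (2 * C))%:E <= 0)%E.
  rewrite -Hs'; apply: le_trans (hausdorff_le s' sub); apply: H => x y hx hy.
  by apply: dust_point_holder => //; rewrite s'0 ltW.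
by move: H; rewrite lee_fin subr0 leNgt divr_gt0// mulr_gt0.
Qed.

(** The vertical section above x of the sum is contained in the translate of
    C by g x. *)
Lemma lebesgue2_vertical_sum_null (R : realType) (C I : set R) (g : R -> R) :
  compact C -> lebesgue_measure C = 0%E -> compact (graph_on g I) ->
  lebesgue2 (minkowski_sum (vertical_copy C) (graph_on g I)) = 0%E.
Proof.
move=> cC C0 cG; set E := (X in minkowski_sum X _); set S := minkowski_sum _ _.
have cE : compact E.
  by apply: (@compact_pair_image _ (fun=> 0) id) => // c; [exact: cvg_cst|exact: cvg_id].
have mS : measurable S by apply: compact_measurable2; exact: compact_minkowski_sum.
have mC : measurable C by apply: closed_measurable; exact: compact_closed.
apply: integral0_eq => x _ /=; apply/eqP; rewrite eq_le measure_ge0 andbT.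
have mf : measurable [set y : R | C (y - g x)].
  have mf : measurable_fun setT (fun y : R => y - g x) by exact: measurable_funB.
  by rewrite -[X in measurable X]setTI; exact: mf.
rewrite -[leRHS]C0 -(lebesgue_measure_translate _ (g x) _ mC).
apply: le_measure; rewrite ?inE//; first exact: measurable_xsection.
move=> y /xsectionP[_ [c Cc <-] [_ [t It <-]]] [/= ].
by rewrite add0r => -> <-; rewrite addrK.
Qed.

(** * Atoms and the decay of Fourier transforms *)

(** The double sum is |sum_j exp (i j v)|^2, hence nonnegative, and it equals
    N^2 when v = 0. *)
Lemma fejer_kernel_ge (R : realType) (N : nat) (v : R) :
  N%:R ^+ 2 * (v == 0)%:R <=
  \sum_(p : 'I_N * 'I_N) cos ((p.1%:R - p.2%:R) * v).
Proof.
rewrite -(pair_bigA _ (fun i j : 'I_N => cos ((i%:R - j%:R) * v)))/=.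
have [->|v0] := eqVneq v 0.
  under eq_bigr do under eq_bigr do rewrite mulr0 cos0.
  by rewrite !sumr_const !card_ord mulr1 -mulrnA -natrX mulnn.
have -> : \sum_(i < N) \sum_(j < N) cos ((i%:R - j%:R) * v) =
    (\sum_(i < N) cos (i%:R * v)) ^+ 2 + (\sum_(i < N) sin (i%:R * v)) ^+ 2.
  rewrite !expr2 !mulr_suml -big_split/=; apply: eq_bigr => i _.
  rewrite !mulr_sumr -big_split/=; apply: eq_bigr => j _.
  by rewrite mulrBl cosB.
by rewrite mulr0 addr_ge0// sqr_ge0.
Qed.

Section atoms.
Context d (T : measurableType d) (R : realType).
Context (nu : {measure set T -> \bar R}) (nuT : (nu setT < +oo)%E).

Lemma integrable_bound (g : T -> R) (B : R) :
  measurable_fun setT g -> (forall x, `|g x| <= B) ->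
  nu.-integrable setT (EFin \o g).
Proof.
move=> mg gB; apply: measurable_bounded_integrable => //.
exists B; split=> [|M M1 x _ /=]; first exact: num_real.
exact: le_trans (gB _) (ltW M1).
Qed.

Lemma measurable_cos_comp (g : T -> R) :
  measurable_fun setT g -> measurable_fun setT (cos \o g).
Proof.
by move=> mg; apply: measurableT_comp => //; apply: continuous_measurable_fun;
  exact: continuous_cos.
Qed.

Lemma measurable_sin_comp (g : T -> R) :
  measurable_fun setT g -> measurable_fun setT (sin \o g).
Proof.
by move=> mg; apply: measurableT_comp => //; apply: continuous_measurable_fun;
  exact: continuous_sin.
Qed.

Lemma norm_cos_le1 (x : R) : `|cos x| <= 1.
Proof. by rewrite ler_norml cos_geN1 cos_le1. Qed.

Lemma norm_sin_le1 (x : R) : `|sin x| <= 1.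
Proof. by rewrite ler_norml sin_geN1 sin_le1. Qed.

(** Shifting f by a constant only rotates the pair formed by the cosine and
    sine integrals. *)
Lemma cos_integral_phase_le (f : T -> R) (a c e : R) : measurable_fun setT f ->
  `|\int[nu]_x cos (a * f x)| <= e -> `|\int[nu]_x sin (a * f x)| <= e ->
  `|\int[nu]_x cos (a * (f x - c))| <= 2 * e.
Proof.
move=> mf hc hs.
have maf : measurable_fun setT (fun x => a * f x) by exact: measurable_funM.
have mc := measurable_cos_comp _ maf; have ms := measurable_sin_comp _ maf.
have -> : \int[nu]_x cos (a * (f x - c)) =
    cos (a * c) * \int[nu]_x cos (a * f x) + sin (a * c) * \int[nu]_x sin (a * f x).
  rewrite -!RintegralZl//; last 2 first.
  - by apply: (integrable_bound _ 1 ms) => x; exact: norm_sin_le1.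
  - by apply: (integrable_bound _ 1 mc) => x; exact: norm_cos_le1.
  rewrite -RintegralD//.
  - apply: eq_Rintegral => x _; rewrite mulrBr cosB.
    by rewrite (mulrC (cos (a * f x))) (mulrC (sin (a * f x))).
  - apply: (integrable_bound _ 1); first exact: measurable_funM.
    by move=> x; rewrite normrM mulr_ile1 ?norm_cos_le1.
  - apply: (integrable_bound _ 1); first exact: measurable_funM.
    by move=> x; rewrite normrM mulr_ile1 ?norm_sin_le1.
apply: le_trans (ler_normD _ _) _; rewrite mulr_natl mulr2n !normrM.
have e0 : 0 <= e by exact: le_trans hc.
by apply: lerD; rewrite -[leRHS]mul1r; apply: ler_pM => //;
  [exact: norm_cos_le1|exact: norm_sin_le1].
Qed.

Lemma Rintegral_sum (I : Type) (s : seq I) (h : I -> T -> R) :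
  (forall i, nu.-integrable setT (EFin \o h i)) ->
  \int[nu]_x (\sum_(i <- s) h i x) = \sum_(i <- s) \int[nu]_x h i x.
Proof.
move=> ih; elim: s => [|i s IH].
  under eq_Rintegral do rewrite big_nil.
  by rewrite Rintegral_cst// mul0r big_nil.
under eq_Rintegral do rewrite big_cons.
rewrite RintegralD//; first by rewrite IH big_cons.
rewrite (_ : _ \o _ = fun x => (\sum_(i <- s) (h i x)%:E)%E).
  by apply: integrable_sum => // j _; exact: ih.
by apply/funext => x /=; rewrite sumEFin.
Qed.

(** Wiener's argument: integrate the Fejer kernel at the frequencies j r0.
    The atom contributes at least N^2 m; the N diagonal terms contribute
    N times the total mass, and if all the cosine integrals were at most m / 4
    the others would contribute at most N^2 m / 4.  This is absurd as soon as
    N exceeds twice the total mass divided by m. *)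
Lemma atom_cos_integral_not_small (f : T -> R) (m r0 : R) :
  measurable_fun setT f -> 0 < m -> (m%:E <= nu [set x | f x = 0%R])%E ->
  exists2 k : nat, (0 < k)%N & m / 4 < `|\int[nu]_x cos (k%:R * r0 * f x)|.
Proof.
move=> mf m0 mA; apply: contrapT => nk.
have small k : (0 < k)%N -> `|\int[nu]_x cos (k%:R * r0 * f x)| <= m / 4.
  by move=> k0; rewrite leNgt; apply/negP => h; apply: nk; exists k.
pose M := fine (nu setT); have M0 : 0 <= M by exact: fine_ge0.
pose N := (Num.truncn (2 * M / m)).+1.
have NM : 2 * M / m < N%:R by exact: truncnS_gt.
pose A := [set x | f x = 0].
have mAs : measurable A.
  rewrite -[A]setTI; exact: (mf measurableT [set 0] (measurable_set1 0)).
have Afin : (nu A < +oo)%E.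
  by apply: le_lt_trans nuT; apply: le_measure; rewrite ?inE.
pose u (p : 'I_N * 'I_N) x := cos ((p.1%:R - p.2%:R) * (r0 * f x)).
have mu p : measurable_fun setT (u p).
  by apply: measurable_cos_comp; do 2 apply: measurable_funM => //.
have iu p : nu.-integrable setT (EFin \o u p).
  by apply: (integrable_bound _ 1 (mu p)) => x; exact: norm_cos_le1.
have ius : nu.-integrable setT (EFin \o (fun x => \sum_p u p x)).
  apply: (integrable_bound _ (\sum_(p : 'I_N * 'I_N) 1)); first exact: measurable_sum.
  move=> x; apply: le_trans (ler_norm_sum _ _ _) _.
  by apply: ler_sum => p _; exact: norm_cos_le1.
have lower : N%:R ^+ 2 * fine (nu A) <= \int[nu]_x \sum_p u p x.
  have mI : measurable_fun setT (fun x => N%:R ^+ 2 * \1_A x : R) by exact: measurable_funM.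
  have -> : N%:R ^+ 2 * fine (nu A) = \int[nu]_x (N%:R ^+ 2 * \1_A x).
    rewrite RintegralZl//; last first.
      apply: (integrable_bound _ 1) => // x.
      by rewrite indicE; case: (_ \in _); rewrite ?normr1 ?normr0.
    by rewrite /Rintegral integral_indic// setIT.
  apply: le_Rintegral => //.
    apply: (integrable_bound _ (N%:R ^+ 2) mI) => x.
    rewrite normrM ger0_norm ?exprn_ge0// ler_piMr ?exprn_ge0//.
    by rewrite indicE; case: (_ \in _); rewrite ?normr1 ?normr0.
  move=> x _; apply: le_trans (fejer_kernel_ge _ N (r0 * f x)).
  rewrite ler_wpM2l ?exprn_ge0// indicE; have [fx|fx] := pselect (A x).
    by rewrite (_ : r0 * f x = 0) ?eqxx ?fx ?mulr0//; case: (_ \in _).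
  by rewrite memNset.
have upper : \int[nu]_x \sum_p u p x <= N%:R * M + N%:R ^+ 2 * (m / 4).
  rewrite Rintegral_sum//.
  apply: (@le_trans _ _ (\sum_(p : 'I_N * 'I_N) ((p.1 == p.2)%:R * M + m / 4))).
    apply: ler_sum => -[i j] _; rewrite /u/=; have [<-|ij] := eqVneq i j.
      under eq_Rintegral do rewrite subrr mul0r cos0.
      by rewrite Rintegral_cst// !mul1r lerDl divr_ge0// ltW.
    rewrite mul0r add0r; apply: le_trans (ler_norm _) _.
    have [k k0 kE] : exists2 k : nat, (0 < k)%N &
        forall x, cos ((i%:R - j%:R) * (r0 * f x)) = cos (k%:R * r0 * f x).
      case: (ltngtP i j) => [lt|lt|/val_inj ij']; last by rewrite ij' eqxx in ij.
      - exists (j - i)%N; rewrite ?subn_gt0// => x.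
        by rewrite -cosN natrB ?(ltnW lt)//; congr cos; ring.
      - exists (i - j)%N; rewrite ?subn_gt0// => x.
        by rewrite natrB ?(ltnW lt)//; congr cos; ring.
    under eq_Rintegral do rewrite kE.
    exact: small.
  rewrite -(pair_bigA _ (fun i j : 'I_N => (i == j)%:R * M + m / 4))/=.
  rewrite (eq_bigr (fun i => M + N%:R * (m / 4))).
    by rewrite sumr_const card_ord -[leLHS]mulr_natl; lra.
  move=> i _; rewrite big_split/= sumr_const card_ord mulr_natl; congr (_ + _).
  rewrite (bigD1 i)//= eqxx mul1r big1 ?addr0// => j ji.
  by rewrite eq_sym (negPf ji) mul0r.
have mA' : m <= fine (nu A) by rewrite -lee_fin fineK// ge0_fin_numE.
have N0 : 0 < N%:R :> R by rewrite ltr0n.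
have : N%:R ^+ 2 * m <= N%:R * M + N%:R ^+ 2 * (m / 4).
  by apply: le_trans (le_trans lower upper); rewrite ler_pM2l ?exprn_gt0.
rewrite expr2 -!mulrA -mulrDr ler_pM2l//.
by move: NM; rewrite ltr_pdivrMr//; lra.
Qed.

End atoms.

Lemma measurable_dotp (R : realType) (v : R * R) :
  measurable_fun setT (fun y : R * R => dotp y v).
Proof.
apply: measurable_funD; apply: measurable_funM => //.
Qed.

Lemma complex_cvg0_bound (R : realType) (f : R -> R[i]) (e : R) : 0 < e ->
  (f r @[r --> +oo] --> (0 : R[i] : numFieldType)) ->
  exists r0 : R, forall r, r0 < r ->
    `|complex.Re (f r)| <= e /\ `|complex.Im (f r)| <= e.
Proof.
move=> e0 cv.
have e0C : (0 < e%:C)%C by rewrite ltcR.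
have [r0 [_ hr]] := (@cvgrPdist_lt _ ((R[i] : numFieldType) : pseudoMetricNormedZmodType _)
  _ (@pinfty_nbhs R) _ f 0).1 cv (e%:C)%C e0C.
exists r0 => r /hr; rewrite sub0r normrN normc_def ltcR => /ltW fe.
by split; apply: le_trans fe; rewrite -sqrtr_sqr ler_wsqrtr// ?lerDl ?lerDr sqr_ge0.
Qed.

(** An atom of the projection of nu on the direction w, located at c. *)
Lemma fourier_atom_not_cvg0 (R : realType) (nu : {measure set (R * R) -> \bar R})
    (w : R * R) (c m : R) :
  (nu setT < +oo)%E -> 0 < m -> (m%:E <= nu [set y | dotp y w = c])%E ->
  ~ (fourier nu (r *: w) @[r --> +oo] --> (0 : R[i] : numFieldType)).
Proof.
move=> nuT m0 mc cv.
have [|r0 hr] := complex_cvg0_bound _ (fun r => fourier nu (r *: w)) (m / 8) _ cv.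
  by rewrite divr_gt0.
pose q := `|r0| + 1; pose a := 2 * pi * q.
have mw := measurable_dotp _ w.
have mwc : measurable_fun setT (fun y : R * R => dotp y w - c) by exact: measurable_funB.
have [|k k0] := @atom_cos_integral_not_small _ _ _ nu nuT _ m a mwc m0.
  apply: le_trans mc _; rewrite le_eqVlt; apply/orP; left; apply/eqP; congr (nu _).
  by apply/seteqP; split=> y /= => [->|/eqP]; rewrite ?subrr// subr_eq0 => /eqP.
apply/negP; rewrite -leNgt.
have kq : r0 < k%:R * q.
  apply: (@lt_le_trans _ _ q); first by rewrite /q (le_lt_trans (ler_norm _))// ltrDl.
  by rewrite ler_peMl ?ler1n// addr_ge0.
have [hc hs] := hr _ kq.
have E y : - (2 * pi * dotp y ((k%:R * q) *: w)) = - (k%:R * a) * dotp y w.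
  rewrite /dotp.
  have [-> ->] : ((k%:R * q) *: w).1 = k%:R * q * w.1 /\
                 ((k%:R * q) *: w).2 = k%:R * q * w.2 by [].
  by rewrite /a; ring.
under eq_Rintegral do rewrite -cosN -mulNr.
apply: le_trans (@cos_integral_phase_le _ _ _ nu nuT _ _ c (m / 8) mw _ _) _; last by lra.
  by move: hc; rewrite /fourier/=; under eq_Rintegral do rewrite E.
by move: hs; rewrite /fourier/=; under eq_Rintegral do rewrite E.
Qed.

Lemma tangent_envelope_affine_piece (R : realType) (K : set R) (g : R -> R) (a b : R) :
  tangent_envelope K g -> (forall q : rat, ~ K (ratr q)) -> a < b ->
  exists k c e, [/\ a <= c, c < e, e <= b &
    forall x, c <= x <= e -> g x = k * x - k ^+ 2 / 2].
Proof.
move=> Kg KQ ab; have [r] := rat_in_itvoo ab; rewrite in_itv/=.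
set q := ratr r => /andP[aq qb].
have [k [kq flat]] := tangent_envelope_flat _ _ _ q Kg (KQ r).
have {}flat x : 0 <= (x - q) / (k - q) <= 1 -> g x = k * x - k ^+ 2 / 2.
  move=> /flat; rewrite divfK ?subr_eq0//.
  by rewrite addrC subrK.
case: (ltgtP k q) kq => // kq _.
  exists k, (Num.max k a), q; split; rewrite ?le_max ?lexx ?orbT ?gt_max ?kq ?aq ?(ltW qb)//.
  move=> x; rewrite ge_max -andbA => /and3P[kx ax xq]; apply: flat.
  have qk0 : 0 < q - k by rewrite subr_gt0.
  rewrite -mulrNN -invrN !opprB; apply/andP; split.
    by apply: divr_ge0; lra.
  by rewrite ler_pdivrMr//; lra.
exists k, q, (Num.min k b); split; rewrite ?ge_min ?lexx ?orbT ?lt_min ?kq ?qb ?(ltW aq)//.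
move=> x; rewrite le_min => /and3P[qx xk xb]; apply: flat.
have kq0 : 0 < k - q by rewrite subr_gt0.
apply/andP; split; first by apply: divr_ge0; lra.
by rewrite ler_pdivrMr//; lra.
Qed.

Lemma interval_gt0_segment (R : realType) (I : interval R) :
  (0 < lebesgue_measure [set` I])%E ->
  exists a b, a < b /\ `[a, b]%classic `<=` [set` I].
Proof.
move=> I0.
have [[a [b [Ia Ib ab]]]|nab] := pselect (exists a b, [/\ a \in I, b \in I & a < b]).
  exists a, b; split=> // x; rewrite /= in_itv/= => xab.
  exact: (@interval_is_interval _ I a b Ia Ib x xab).
have [[a Ia]|na] := pselect (exists a, a \in I).
  have : (lebesgue_measure [set` I] <= lebesgue_measure [set a])%E.
    apply: le_measure; rewrite ?inE// => x /= Ix; case: (ltgtP x a) => // xa; exfalso.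
      by apply: nab; exists x, a.
    by apply: nab; exists a, x.
  by rewrite lebesgue_measure_set1 leNgt I0.
move: I0; rewrite (_ : [set` I] = set0) ?measure0 ?ltxx//.
by rewrite -subset0 => x Ix; apply: na; exists x.
Qed.

Lemma enormZ (R : realType) (r : R) (x : R * R) : enorm (r *: x) = `|r| * enorm x.
Proof.
have -> : enorm (r *: x) = Num.sqrt (r ^+ 2 * (x.1 ^+ 2 + x.2 ^+ 2)).
  congr Num.sqrt; rewrite mulrDr -!exprMn.
  by [].
by rewrite sqrtrM ?sqr_ge0// sqrtr_sqr.
Qed.

Lemma rajchman_direction (R : realType) (nu : {measure set (R * R) -> \bar R})
    (w : R * R) : enorm w = 1 -> rajchman nu ->
  fourier nu (r *: w) @[r --> +oo] --> (0 : R[i] : numFieldType).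
Proof.
move=> w1 rnu; apply: cvg_comp rnu => A [M _ MA].
exists M; split; first exact: num_real.
move=> r Mr; apply: MA => /=; rewrite enormZ w1 mulr1.
exact: lt_le_trans (ler_norm r).
Qed.

(** The normal to the segment of slope k in the graph over I is (k, -1), up to
    normalisation; the whole segment projects to a single point, so that its
    length is a lower bound for the atom. *)
Lemma tangent_envelope_not_rajchman (R : realType) (K : set R) (g : R -> R)
    (I : interval R) :
  K `<=` `[1, 2]%classic -> tangent_envelope K g -> (forall q : rat, ~ K (ratr q)) ->
  [set` I] `<=` `[1, 2]%classic -> (0 < lebesgue_measure [set` I])%E ->
  exists2 w : R * R, enorm w = 1 &
    ~ (fourier (hausdorff_restr 1 (graph_on g [set` I])) (r *: w) @[r --> +oo] -->
       (0 : R[i] : numFieldType)).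
Proof.
move=> K12 Kg KQ I12 /interval_gt0_segment[a [b [ab abI]]].
have [k [c [e [ac ce eb gk]]]] := tangent_envelope_affine_piece _ _ _ _ _ Kg KQ ab.
pose rho : R := Num.sqrt (k ^+ 2 + 1).
have rho0 : 0 < rho by rewrite sqrtr_gt0 ltr_wpDl// sqr_ge0.
pose w : R * R := (k / rho, - rho^-1).
exists w.
  have rho2 : rho ^+ 2 = k ^+ 2 + 1 by rewrite sqr_sqrtr// addr_ge0// sqr_ge0.
  rewrite /enorm/w/= (_ : _ + _ = (k ^+ 2 + 1) / rho ^+ 2); last by field; rewrite gt_eqF.
  by rewrite rho2 divff ?sqrtr1// -rho2 expf_neq0// gt_eqF.
apply: (@fourier_atom_not_cvg0 _ _ w (k ^+ 2 / 2 / rho) ((e - c) / 2)).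
- apply: le_lt_trans (ltry 16).
  apply: (@le_trans _ _ (hausdorff 1 (graph_on g `[1%R, 2%R]%classic))).
    by apply: hausdorff_le => _ [_ [x Ix <-]]; exists x => //; exact: I12.
  by apply: hausdorff1_graph_le => x y; exact: tangent_envelope_lip Kg.
- by rewrite divr_gt0 ?subr_gt0.
apply: le_trans (hausdorff1_graph_ge _ g _ _ (ltW ce)) _.
apply: hausdorff_le => _ [x xce <-].
move: xce; rewrite /= in_itv/= => xce; split.
  by rewrite /= /dotp/= gk//; field; rewrite gt_eqF.
exists x => //; apply: abI; rewrite /= in_itv/=.
by move: xce => /andP[cx xe]; rewrite (le_trans ac) ?(le_trans xe).
Qed.

(** * The threshold of the envelope *)

(** For s < 1 the Cantor set of ratio r with r^s = 1/2 has r < 1/2, hence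
    measure zero. *)
Lemma exists_null_compact_dimH_gt (R : realType) (t : R) : t < 1 ->
  exists C : set R, [/\ compact C, lebesgue_measure C = 0%E &
    (t%:E < dimH (vertical_copy C))%E].
Proof.
move=> t1; pose s := (1 + Num.max 0 t) / 2.
have [m0 [mt m1]] : 0 <= Num.max 0 t /\ t <= Num.max 0 t /\ Num.max 0 t < 1.
  by rewrite !le_max lexx lexx orbT gt_max t1 ltr01.
have s0 : 0 < s by rewrite /s; lra.
have s1 : s < 1 by rewrite /s; lra.
have ts : t < s by rewrite /s; lra.
pose r : R := 2^-1 `^ s^-1.
have r0 : 0 < r by rewrite powR_gt0.
have r2 : 2 * r < 1 by apply: half_powR_lt; rewrite invf_gt1.
exists (cantor_dust r); split.
- exact: compact_cantor_dust.
- exact: cantor_dust_null.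
- apply: lt_le_trans (dimH_cantor_dust _ r s r0 r2 (ltW s0) _); first by rewrite lte_fin.
  by rewrite /r -powRrM mulVf ?gt_eqF// powRr1.
Qed.

Lemma lipschitz_bound_continuous (R : realType) (g : R -> R) (k : R) : 0 < k ->
  (forall x y, `|g x - g y| <= k * `|x - y|) -> continuous g.
Proof.
move=> k0 gk x; apply/cvgrPdist_le => e e0.
near=> y; apply: le_trans (gk x y) _; rewrite -ler_pdivlMl// mulrC.
by near: y; apply: cvgr_dist_le; [exact: cvg_id|rewrite divr_gt0].
Unshelve. all: by end_near. Qed.

Lemma sum_threshold_envelope (R : realType) (K : set R) (g : R -> R) :
  compact K -> K `<=` `[1, 2]%classic -> (0 < lebesgue_measure K)%E ->
  tangent_envelope K g -> sum_threshold (graph_on g `[1, 2]%classic) = 1%E.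
Proof.
move=> cK K12 K0 Kg.
have cg : continuous g.
  by apply: (@lipschitz_bound_continuous _ g 2) => // x y; exact: tangent_envelope_lip Kg.
have cG : compact (graph_on g `[1, 2]%classic).
  apply: (@compact_pair_image _ id g) => //; last exact: segment_compact.
  by move=> x; exact: cvg_id.
apply/eqP; rewrite eq_le; apply/andP; split.
  apply: ereal_inf_lbound; exists 1 => // E cE E1.
  have mK : measurable K by apply: closed_measurable; exact: compact_closed.
  apply: (lebesgue2_minkowski_sum_gt0 _ _ _ _ mK K12 K0 cE cG) => // k Kk.
  exists k; first exact: K12.
  by rewrite (tangent_envelope_contact _ _ _ _ Kg Kk).
apply: le_ereal_inf_tmp => _ [t tP <-]; rewrite lee_fin leNgt; apply/negP => t1.
have [C [cC C0 Ct]] := exists_null_compact_dimH_gt _ _ t1.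
have cE : compact (vertical_copy C).
  by apply: (@compact_pair_image _ (fun=> 0) id) => // c; [exact: cvg_cst|exact: cvg_id].
by have := tP _ cE Ct; rewrite lebesgue2_vertical_sum_null// ltxx.
Qed.

Theorem theorem1p6 (R : realType) :
  exists gamma0 : R -> R,
    [/\ convex_function (`[1, 2]%classic : set R) gamma0,
        [lipschitz gamma0 x | x in `[1, 2]%classic],
        sum_threshold (graph_on gamma0 `[1, 2]%classic) = 1%E &
        forall I : interval R,
          [set` I] `<=` `[1, 2]%classic ->
          (0 < lebesgue_measure [set` I])%E ->
          let sigma := hausdorff_restr 1 (graph_on gamma0 [set` I]) in
          ~ rajchman sigma /\
          exists2 omega : R * R, enorm omega = 1 &
            ~ (fourier sigma (r *: omega) @[r --> +oo] -->
                 (0 : R[i] : numFieldType))].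
Proof.
have [K [cK K12 K0 KQ]] := fat_compact_without_rationals R.
have Kn : K !=set0.
  by apply/set0P; apply: contraTneq K0 => ->; rewrite measure0 ltxx.
have [g Kg] := tangent_envelope_exists _ _ cK Kn.
exists g; split.
- exact: tangent_envelope_convex Kg.
- exists 2; split; first exact: num_real.
  move=> M M2 [x y] _ /=; apply: le_trans (tangent_envelope_lip _ _ _ x y K12 Kg) _.
  by rewrite ler_wpM2r// ltW.
- exact: sum_threshold_envelope Kg.
- move=> I I12 I0 sigma.
  have [w w1 nw] := tangent_envelope_not_rajchman _ _ _ _ K12 Kg KQ I12 I0.
  split; last by exists w.
  by move=> /(rajchman_direction _ _ _ w1).
Qed.
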